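(* Let $\mathcal{A}=(\mathbf{A}_1,\mathbf{A})$ be a conic quantum space and $\sigma$ a linear automorphism of $\mathbf{A}_1$ which extends to a quantum space automorphism of $\mathcal{A}$; let $\underline{end}^\Upsilon[\mathcal{A}]=\mathcal{A}^\Upsilon\triangleright\mathcal{A}^\Upsilon$ and let $\chi$ be the associated 2-form on $\mathbf{A}\triangleright\mathbf{A}$. Then the twisting $(\mathbf{A}\triangleright\mathbf{A})_\chi$ of the bialgebra $\mathbf{A}\triangleright\mathbf{A}$ by $\chi$ defines a pair $$\underline{end}[\mathcal{A}]_\chi=(\mathcal{A}\triangleright\mathcal{A})_\chi:=\big(\mathbf{A}_1^*\otimes\mathbf{A}_1,(\mathbf{A}\triangleright\mathbf{A})_\chi\big)$$ isomorphic (as quantum spaces and as bialgebras) to $\mathcal{A}^\Upsilon\triangleright\mathcal{A}^\Upsilon=\underline{end}^\Upsilon[\mathcal{A}]$. In other terms, there exists a counital 2-cocycle $\chi$ such that $\underline{end}^\Upsilon[\mathcal{A}]\simeq\underline{end}[\mathcal{A}]_\chi$.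
   Context: $\Bbbk$ is $\mathbb{R}$ or $\mathbb{C}$; algebras are unital associative $\Bbbk$-algebras. A quantum space is a pair $\mathcal{A}=(\mathbf{A}_1,\mathbf{A})$, where $\mathbf{A}$ is an algebra generated by a finite-dimensional linear subspace $\mathbf{A}_1\subset\mathbf{A}$; morphisms $(\mathbf{A}_1,\mathbf{A})\to(\mathbf{B}_1,\mathbf{B})$ are algebra homomorphisms $\alpha$ with $\alpha(\mathbf{A}_1)\subset\mathbf{B}_1$. It is conic if the kernel of the canonical epimorphism $\Pi:\mathbf{A}_1^{\otimes}\to\mathbf{A}$ from the tensor algebra is graded, $\ker\Pi=\mathbf{I}=\bigoplus_n\mathbf{I}_n$, $\mathbf{I}_n\subset\mathbf{A}_1^{\otimes n}$, $\mathbf{I}_0=\mathbf{I}_1=0$. For conic $\mathcal{B},\mathcal{A}$ with $\mathbf{B}\simeq\mathbf{B}_1^\otimes/\bigoplus_n\mathbf{J}_n$, $\mathbf{A}\simeq\mathbf{A}_1^\otimes/\bigoplus_n\mathbf{I}_n$, put $\mathcal{B}\triangleright\mathcal{A}=(\mathbf{B}_1^*\otimes\mathbf{A}_1,\mathbf{B}\triangleright\mathbf{A})$, where $\mathbf{B}\triangleright\mathbf{A}$ is the quotient of the algebra $\bigoplus_n\mathbf{B}_1^{*\otimes n}\otimes\mathbf{A}_1^{\otimes n}$ (subalgebra of $\mathbf{B}_1^{*\otimes}\otimes\mathbf{A}_1^\otimes$, canonically the tensor algebra of $\mathbf{B}_1^*\otimes\mathbf{A}_1$) by the two-sided ideal generated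 by $\bigoplus_{n\ge2}\mathbf{J}_n^\perp\otimes\mathbf{I}_n$, with $\mathbf{J}_n^\perp\subset\mathbf{B}_1^{*\otimes n}$ the annihilator of $\mathbf{J}_n$. Write $\underline{end}[\mathcal{A}]=\mathcal{A}\triangleright\mathcal{A}$. With a basis $\{a_i\}$ of $\mathbf{A}_1$, dual basis $\{a^j\}$ and $z_i^j=a^j\otimes a_i$, the algebra $\mathbf{A}\triangleright\mathbf{A}$ is a bialgebra with $\Delta z_i^j=\sum_kz_i^k\otimes z_k^j$, $\varepsilon(z_i^j)=\delta_i^j$; denote its structure by $(\mu,\eta,\Delta,\varepsilon)$. Given $\sigma$ extending to an automorphism of $\mathcal{A}$, $\mathcal{A}^\Upsilon=(\mathbf{A}_1,\mathbf{A}_1^\otimes/\mathbf{I}_\sigma)$ with $(\mathbf{I}_\sigma)_n=(id\otimes\sigma\otimes\sigma^2\otimes\cdots\otimes\sigma^{n-1})(\mathbf{I}_n)$. Its $\underline{end}^\Upsilon[\mathcal{A}]=\mathcal{A}^\Upsilon\triangleright\mathcal{A}^\Upsilon$ has the bialgebra structure given by the same formulas on generators $z_i^j$. With $\sigma(a_i)=\sum_j\sigma_i^ja_j$, the 2-form $\chi:(\mathbf{A}\triangleright\mathbf{A})\otimes(\mathbf{A}\triangleright\mathbf{A})\to\Bbbk$ is the linear form with $$\chi\big(z_{i_1}^{j_1}\cdots z_{i_r}^{j_r}\otimes z_{i_{r+1}}^{j_{r+1}}\cdots z_{i_{r+s}}^{j_{r+s}}\big)=\delta_{i_1}^{j_1}\cdots\delta_{i_r}^{j_r}\,(\sigma^{-r})_{i_{r+1}}^{j_{r+1}}\cdots(\sigma^{-r})_{i_{r+s}}^{j_{r+s}},$$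 and $\chi(1\otimes x)=\chi(x\otimes1)=\varepsilon(x)$ (counitality). A form $\chi$ is a 2-cocycle if $\chi_{12}*\chi(\mu\otimes I)=\chi_{23}*\chi(I\otimes\mu)$, where $*$ is convolution of linear forms on the tensor powers, $\chi_{12}=\chi\otimes\varepsilon$, $\chi_{23}=\varepsilon\otimes\chi$. The twisted bialgebra $(\mathbf{A}\triangleright\mathbf{A})_\chi$ is the same vector space with structure $(\mu_\chi,\eta,\Delta,\varepsilon)$, $\mu_\chi=\chi*\mu*\chi^{-1}$ (convolution on $(\mathbf{A}\triangleright\mathbf{A})^{\otimes2}$; $\chi^{-1}$ the convolution inverse). *)

(* Defs.v *)
From HB Require Import structures.
From mathcomp Require Import all_boot all_order all_algebra.
From mathcomp Require Import generic_quotient finmap.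
From mathcomp Require Import monalg.
From mathcomp Require Import boolp reals complex.

Set Implicit Arguments.
Unset Strict Implicit.
Unset Printing Implicit Defensive.
Import GRing.Theory.
Local Open Scope ring_scope.
Local Open Scope quotient_scope.

Variant ground_kind := RealNumbers | ComplexNumbers.

Definition ground (R : realType) (k : ground_kind) : fieldType :=
  match k with
  | RealNumbers => R : fieldType
  | ComplexNumbers => R[i] : fieldType
  end.

(* The linear extension to {malg K[G]} of a map defined on the basis G. *)
Section LinearExtension.
Variables (K : fieldType) (G : choiceType) (U : lmodType K) (F : G -> U).

Definition mext (x : {malg K[G]}) : U := \sum_(g <- msupp x) x@_g *: F g.

Lemma mextEw (d : {fset G}) (x : {malg K[G]}) :
  (msupp x `<=` d)%fset -> mext x = \sum_(g <- d) x@_g *: F g.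
Proof.
move=> le; rewrite /mext (big_fset_incl _ le) => //= g _ /mcoeff_outdom ->.
by rewrite scale0r.
Qed.

Lemma mext_is_linear : linear mext.
Proof.
move=> a x y; set d := (msupp x `|` msupp y)%fset.
have lex : (msupp x `<=` d)%fset by apply: fsubsetUl.
have ley : (msupp y `<=` d)%fset by apply: fsubsetUr.
have le : (msupp (a *: x + y) `<=` d)%fset.
  apply: fsubset_trans (msuppD_le _ _) _; apply/fsetUSS => //.
  exact: msuppZ_le.
rewrite (mextEw lex) (mextEw ley) (mextEw le) scaler_sumr -big_split /=.
by apply: eq_bigr => g _; rewrite mcoeffD mcoeffZ scalerDl scalerA.
Qed.

HB.instance Definition _ :=
  GRing.isLinear.Build K {malg K[G]} U *:%R mext mext_is_linear.

Lemma mextU g : mext << g >> = F g.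
Proof. by rewrite (mextEw msuppU_le) big_seq_fset1 mcoeffUU scale1r. Qed.

End LinearExtension.

Section Quotient.
Variables (K : fieldType) (M : lmodType K) (S : M -> Prop).

Inductive lspan : M -> Prop :=
| lspan_gen x : S x -> lspan x
| lspan0 : lspan 0
| lspanP a x y : lspan x -> lspan y -> lspan (a *: x + y).

Lemma lspanZ a x : lspan x -> lspan (a *: x).
Proof. by move=> hx; rewrite -[_ *: _]addr0; apply: lspanP => //; apply: lspan0. Qed.

Lemma lspanD x y : lspan x -> lspan y -> lspan (x + y).
Proof. by move=> hx hy; rewrite -[x]scale1r; apply: lspanP. Qed.

Lemma lspanN x : lspan x -> lspan (- x).
Proof. by move=> hx; rewrite -scaleN1r; apply: lspanZ. Qed.

Definition lspan_eqv : rel M := fun x y => `[< lspan (x - y) >].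

Lemma lspan_eqv_refl : reflexive lspan_eqv.
Proof. by move=> x; apply/asboolP; rewrite subrr; apply: lspan0. Qed.

Lemma lspan_eqv_sym : symmetric lspan_eqv.
Proof.
move=> x y; apply/asboolP/asboolP => /lspanN; by rewrite opprB.
Qed.

Lemma lspan_eqv_trans : transitive lspan_eqv.
Proof.
move=> y x z /asboolP h1 /asboolP h2; apply/asboolP.
by have := lspanD h1 h2; rewrite addrA subrK.
Qed.

Canonical lspan_equiv :=
  EquivRel lspan_eqv lspan_eqv_refl lspan_eqv_sym lspan_eqv_trans.

(* The quotient of M by the span of S. *)
Definition quot_mod : Type := {eq_quot lspan_equiv}.

HB.instance Definition _ := Choice.on quot_mod.
HB.instance Definition _ := EqQuotient.on quot_mod.

Definition qproj (x : M) : quot_mod := \pi_({eq_quot lspan_equiv}) x.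
Definition qrepr (x : quot_mod) : M := repr (x : {eq_quot lspan_equiv}).

Lemma qreprK x : qproj (qrepr x) = x.
Proof. exact: (@reprK _ {eq_quot lspan_equiv}). Qed.

Lemma qprojP x y : qproj x = qproj y <-> lspan (x - y).
Proof.
split=> [/(@eqmodP _ lspan_equiv)/asboolP //|h].
by apply/(@eqmodP _ lspan_equiv)/asboolP.
Qed.

Lemma qrepr_proj x : lspan (qrepr (qproj x) - x).
Proof. by apply/qprojP; rewrite qreprK. Qed.

Lemma qprojW (P : quot_mod -> Prop) : (forall x, P (qproj x)) -> forall x, P x.
Proof. by move=> h x; rewrite -[x]qreprK. Qed.

Definition qzero : quot_mod := qproj 0.
Definition qopp (x : quot_mod) : quot_mod := qproj (- qrepr x).
Definition qadd (x y : quot_mod) : quot_mod := qproj (qrepr x + qrepr y).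
Definition qscale (a : K) (x : quot_mod) : quot_mod := qproj (a *: qrepr x).

Lemma qoppE x : qopp (qproj x) = qproj (- x).
Proof.
by apply/qprojP; rewrite -opprD; apply/lspanN/qrepr_proj.
Qed.

Lemma qaddE x y : qadd (qproj x) (qproj y) = qproj (x + y).
Proof.
by apply/qprojP; rewrite opprD addrACA; apply: lspanD; apply: qrepr_proj.
Qed.

Lemma qscaleE a x : qscale a (qproj x) = qproj (a *: x).
Proof. by apply/qprojP; rewrite -scalerBr; apply/lspanZ/qrepr_proj. Qed.

Lemma qaddA : associative qadd.
Proof.
elim/qprojW=> x; elim/qprojW=> y; elim/qprojW=> z.
by rewrite !qaddE addrA.
Qed.

Lemma qaddC : commutative qadd.
Proof. by elim/qprojW=> x; elim/qprojW=> y; rewrite !qaddE addrC. Qed.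

Lemma qadd0 : left_id qzero qadd.
Proof. by elim/qprojW=> x; rewrite qaddE add0r. Qed.

Lemma qaddN : left_inverse qzero qopp qadd.
Proof. by elim/qprojW=> x; rewrite qoppE qaddE addNr. Qed.

HB.instance Definition _ :=
  GRing.isZmodule.Build quot_mod qaddA qaddC qadd0 qaddN.

Lemma qprojD x y : qproj (x + y) = qproj x + qproj y.
Proof. by rewrite -qaddE. Qed.

Lemma qscaleA a b (x : quot_mod) : qscale a (qscale b x) = qscale (a * b) x.
Proof. by elim/qprojW: x => x; rewrite !qscaleE scalerA. Qed.

Lemma qscale1 : left_id 1 qscale.
Proof. by elim/qprojW=> x; rewrite qscaleE scale1r. Qed.

Lemma qscaleDr : right_distributive qscale +%R.
Proof.
move=> a; elim/qprojW=> x; elim/qprojW=> y.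
by rewrite -qprojD !qscaleE -qprojD scalerDr.
Qed.

Lemma qscaleDl (x : quot_mod) : {morph qscale^~ x : a b / a + b}.
Proof.
elim/qprojW: x => x a b /=.
by rewrite !qscaleE -qprojD scalerDl.
Qed.

HB.instance Definition _ :=
  GRing.Zmodule_isLmodule.Build K quot_mod qscaleA qscale1 qscaleDr qscaleDl.

Lemma qproj_is_linear : linear qproj.
Proof.
by move=> a x y; rewrite qprojD -qscaleE.
Qed.

HB.instance Definition _ :=
  GRing.isLinear.Build K M quot_mod *:%R qproj qproj_is_linear.

End Quotient.

Section QuotientAlgebra.
Variables (K : fieldType) (A : algType K) (S : A -> Prop).

Definition ideal_products (x : A) : Prop :=
  exists a s b : A, S s /\ x = a * s * b.

(* The two-sided ideal of A generated by S. *)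
Definition ideal_gen : A -> Prop := lspan ideal_products.

Lemma ideal_gen_in x : S x -> ideal_gen x.
Proof.
move=> hx; apply: lspan_gen; exists 1, x, 1; split=> //.
by rewrite mul1r mulr1.
Qed.

Lemma ideal_genMl a x : ideal_gen x -> ideal_gen (a * x).
Proof.
elim=> [y [b [s [c [hs ->]]]]||c y z _ hy _ hz].
- by apply: lspan_gen; exists (a * b), s, c; rewrite !mulrA.
- by rewrite mulr0; apply: lspan0.
- by rewrite mulrDr -scalerAr; apply: lspanP.
Qed.

Lemma ideal_genMr a x : ideal_gen x -> ideal_gen (x * a).
Proof.
elim=> [y [b [s [c [hs ->]]]]||c y z _ hy _ hz].
- by apply: lspan_gen; exists b, s, (c * a); rewrite !mulrA.
- by rewrite mul0r; apply: lspan0.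
- by rewrite mulrDl -scalerAl; apply: lspanP.
Qed.

Hypothesis proper : ~ ideal_gen 1.

Definition quot_alg (_ : ~ ideal_gen 1) : Type := quot_mod ideal_products.
Local Notation Q := (quot_alg proper).

HB.instance Definition _ := GRing.Lmodule.on Q.

Definition aproj (x : A) : Q := qproj ideal_products x.
Definition qone : Q := aproj 1.
Definition qmul (x y : Q) : Q := aproj (qrepr x * qrepr y).

Lemma qmulE x y : qmul (aproj x) (aproj y) = aproj (x * y).
Proof.
apply/qprojP; set x' := qrepr _; set y' := qrepr _.
have -> : x' * y' - x * y = (x' - x) * y' + x * (y' - y).
  by rewrite mulrBl mulrBr addrA subrK.
apply: lspanD; first by apply/ideal_genMr/qrepr_proj.
by apply/ideal_genMl/qrepr_proj.
Qed.

Lemma aprojW (P : Q -> Prop) : (forall x, P (aproj x)) -> forall x, P x.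
Proof. exact: qprojW. Qed.

Lemma aproj_is_linear : linear aproj.
Proof. exact: qproj_is_linear. Qed.

HB.instance Definition _ :=
  GRing.isLinear.Build K A Q *:%R aproj aproj_is_linear.

Lemma aprojZ a x : aproj (a *: x) = a *: aproj x.
Proof. exact: linearZ. Qed.

Lemma qmulA : associative qmul.
Proof.
elim/aprojW=> x; elim/aprojW=> y; elim/aprojW=> z.
by rewrite !qmulE mulrA.
Qed.

Lemma qmul1r : left_id qone qmul.
Proof. by elim/aprojW=> x; rewrite qmulE mul1r. Qed.

Lemma qmulr1 : right_id qone qmul.
Proof. by elim/aprojW=> x; rewrite qmulE mulr1. Qed.

Lemma qmulDl : left_distributive qmul +%R.
Proof.
elim/aprojW=> x; elim/aprojW=> y; elim/aprojW=> z.
by rewrite -linearD !qmulE -linearD mulrDl.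
Qed.

Lemma qmulDr : right_distributive qmul +%R.
Proof.
elim/aprojW=> x; elim/aprojW=> y; elim/aprojW=> z.
by rewrite -linearD !qmulE -linearD mulrDr.
Qed.

Lemma qone_neq0 : qone != 0 :> Q.
Proof.
apply/eqP; rewrite -(linear0 aproj) => /qprojP.
by rewrite subr0.
Qed.

HB.instance Definition _ := GRing.Zmodule_isNzRing.Build Q
  qmulA qmul1r qmulr1 qmulDl qmulDr qone_neq0.

Lemma aprojM x y : aproj (x * y) = aproj x * aproj y.
Proof. by rewrite -qmulE. Qed.

Lemma qscaleAl (a : K) (x y : Q) : a *: (x * y) = (a *: x) * y.
Proof.
elim/aprojW: x => x; elim/aprojW: y => y.
by rewrite -aprojM -!aprojZ -aprojM scalerAl.
Qed.

HB.instance Definition _ := GRing.Lmodule_isLalgebra.Build K Q qscaleAl.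

Lemma qscaleAr (a : K) (x y : Q) : a *: (x * y) = x * (a *: y).
Proof.
elim/aprojW: x => x; elim/aprojW: y => y.
by rewrite -aprojM -!aprojZ -aprojM scalerAr.
Qed.

HB.instance Definition _ := GRing.Lalgebra_isAlgebra.Build K Q qscaleAr.

Lemma aproj_is_monoid_morphism : monoid_morphism aproj.
Proof. by split=> // x y; apply: aprojM. Qed.

HB.instance Definition _ :=
  GRing.isMonoidMorphism.Build A Q aproj aproj_is_monoid_morphism.

End QuotientAlgebra.

Section TensorProduct.
Variables (K : fieldType) (V W : lmodType K).

(* The relations imposed on the vector space freely generated by V * W. *)
Variant bilinear_relation : {malg K[(V * W)%type]} -> Prop :=
| bilinear_l a v v' w : bilinear_relation
    (<< (a *: v + v', w) >> - (a *: << (v, w) >> + << (v', w) >>))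
| bilinear_r a v w w' : bilinear_relation
    (<< (v, a *: w + w') >> - (a *: << (v, w) >> + << (v, w') >>)).

Definition tens : Type := quot_mod bilinear_relation.

HB.instance Definition _ := GRing.Lmodule.on tens.

Definition tpure (v : V) (w : W) : tens := qproj bilinear_relation << (v, w) >>.

Lemma tpure_linear_l w : linear (tpure^~ w).
Proof.
move=> a v v'; rewrite /tpure -linearZ -linearD.
by apply/qprojP/lspan_gen; apply: bilinear_l.
Qed.

Lemma tpure_linear_r v : linear (tpure v).
Proof.
move=> a w w'; rewrite /tpure -linearZ -linearD.
by apply/qprojP/lspan_gen; apply: bilinear_r.
Qed.

(* The linear map V (x) W -> U given by F, when F is bilinear. *)
Definition tens_lift (U : lmodType K) (F : V -> W -> U) (t : tens) : U :=
  mext (fun p => F p.1 p.2) (qrepr t).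

Section Lift.
Variables (U : lmodType K) (F : V -> W -> U).
Hypotheses (Fl : forall w, linear (F^~ w)) (Fr : forall v, linear (F v)).

Lemma mext_bilinear_relation x :
  lspan (@bilinear_relation) x -> mext (fun p => F p.1 p.2) x = 0.
Proof.
elim=> {x} [_ [a v v' w|a v w w']||a x y _ hx _ hy].
- by rewrite linearB linearP /= !mextU /= Fl subrr.
- by rewrite linearB linearP /= !mextU /= Fr subrr.
- by rewrite linear0.
- by rewrite linearP /= hx hy scaler0 addr0.
Qed.

Lemma tens_lift_proj x :
  tens_lift F (qproj bilinear_relation x) = mext (fun p => F p.1 p.2) x.
Proof.
by apply/eqP; rewrite -subr_eq0 -linearB /= mext_bilinear_relation //; apply: qrepr_proj.
Qed.

Lemma tens_liftE v w : tens_lift F (tpure v w) = F v w.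
Proof. by rewrite tens_lift_proj mextU. Qed.

Lemma tens_lift_linear : linear (tens_lift F).
Proof.
move=> a; elim/qprojW=> x; elim/qprojW=> y.
by rewrite -linearP !tens_lift_proj linearP.
Qed.

End Lift.

Lemma tens_lift_param (X U : lmodType K) (F : X -> V -> W -> U) (t : tens) :
  (forall v w, linear (fun x => F x v w)) -> linear (fun x => tens_lift (F x) t).
Proof.
move=> FL a x y; rewrite /tens_lift /mext scaler_sumr -big_split /=.
apply: eq_bigr => p _; rewrite FL scalerDr !scalerA; congr (_ *: _ + _).
exact: mulrC.
Qed.

End TensorProduct.

Notation "v *t w" := (tpure v w) (at level 40, left associativity) : ring_scope.

Section TensorMaps.
Variable K : fieldType.
Implicit Types U V W X : lmodType K.

Definition tmap V V' W W' (f : {linear V -> W}) (g : {linear V' -> W'}) :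
    tens V V' -> tens W W' :=
  tens_lift (fun v v' => f v *t g v').

Definition tassoc U V W : tens (tens U V) W -> tens U (tens V W) :=
  tens_lift (fun t w => tens_lift (fun u v => u *t (v *t w)) t).

(* (u (x) v) (x) (w (x) x) |-> (u (x) w) (x) (v (x) x) *)
Definition tmiddle U V W X :
    tens (tens U V) (tens W X) -> tens (tens U W) (tens V X) :=
  tens_lift (fun s t =>
    tens_lift (fun u v => tens_lift (fun w x => (u *t w) *t (v *t x)) t) s).

Definition tscale_l V : tens K^o V -> V := tens_lift (fun (a : K^o) v => a *: v).
Definition tscale_r V : tens V K^o -> V := tens_lift (fun v (a : K^o) => a *: v).

Definition tmul (B : algType K) : tens B B -> B := tens_lift (fun x y : B => x * y).

Lemma tmap_is_linear V V' W W' f g : linear (@tmap V V' W W' f g).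
Proof.
apply: tens_lift_linear => [v' a x y|v a x y].
  by rewrite linearP tpure_linear_l.
by rewrite linearP tpure_linear_r.
Qed.
HB.instance Definition _ V V' W W' f g :=
  GRing.isLinear.Build K (tens V V') (tens W W') *:%R _ (@tmap_is_linear V V' W W' f g).

Lemma tassoc_is_linear U V W : linear (@tassoc U V W).
Proof.
apply: tens_lift_linear => [w|t].
  apply: tens_lift_linear => [v a x y|u a x y].
    by rewrite tpure_linear_l.
  by rewrite tpure_linear_l tpure_linear_r.
by apply: tens_lift_param => u v a x y; rewrite !tpure_linear_r.
Qed.
HB.instance Definition _ U V W :=
  GRing.isLinear.Build K (tens (tens U V) W) (tens U (tens V W)) *:%R _
    (@tassoc_is_linear U V W).

Lemma tmiddle_is_linear U V W X : linear (@tmiddle U V W X).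
Proof.
apply: tens_lift_linear => [t|s].
  apply: tens_lift_linear => [v|u]; apply: tens_lift_param => w x a y z.
    by rewrite !tpure_linear_l.
  by rewrite tpure_linear_l tpure_linear_r.
apply: tens_lift_param => u v; apply: tens_lift_linear => [x a y z|w a y z].
  by rewrite tpure_linear_r tpure_linear_l.
by rewrite !tpure_linear_r.
Qed.
HB.instance Definition _ U V W X :=
  GRing.isLinear.Build K (tens (tens U V) (tens W X)) (tens (tens U W) (tens V X))
    *:%R _ (@tmiddle_is_linear U V W X).

Lemma tscale_l_is_linear V : linear (@tscale_l V).
Proof.
apply: tens_lift_linear => [v a x y|b a x y].
  by rewrite scalerDl scalerA.
by rewrite scalerDr !scalerA mulrC.
Qed.
HB.instance Definition _ V :=
  GRing.isLinear.Build K (tens K^o V) V *:%R _ (@tscale_l_is_linear V).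

Lemma tscale_r_is_linear V : linear (@tscale_r V).
Proof.
apply: tens_lift_linear => [b a x y|v a x y].
  by rewrite scalerDr !scalerA mulrC.
by rewrite scalerDl scalerA.
Qed.
HB.instance Definition _ V :=
  GRing.isLinear.Build K (tens V K^o) V *:%R _ (@tscale_r_is_linear V).

Lemma tmul_is_linear (B : algType K) : linear (@tmul B).
Proof.
apply: tens_lift_linear => [b a x y|b a x y].
  by rewrite mulrDl scalerAl.
by rewrite mulrDr scalerAr.
Qed.
HB.instance Definition _ (B : algType K) :=
  GRing.isLinear.Build K (tens B B) B *:%R _ (@tmul_is_linear B).

End TensorMaps.

Section AlgebraOfProduct.
Variables (K : fieldType) (V : lmodType K) (mul : {linear tens V V -> V}) (one : V).

Definition algebra_axioms : Prop :=
  [/\ forall x y z, mul (x *t mul (y *t z)) = mul (mul (x *t y) *t z),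
      forall x, mul (one *t x) = x,
      forall x, mul (x *t one) = x
    & one != 0].

Variable ax : algebra_axioms.

(* V as an algebra, with product mul and unit one. *)
Definition alg_of (_ : algebra_axioms) : Type := V.
Local Notation A := (alg_of ax).

HB.instance Definition _ := GRing.Lmodule.on A.

Definition alg_of_mul (x y : A) : A := mul ((x : V) *t (y : V)).

Lemma alg_of_mulA : associative alg_of_mul.
Proof. by case: ax. Qed.

Lemma alg_of_mul1r : left_id one alg_of_mul.
Proof. by case: ax. Qed.

Lemma alg_of_mulr1 : right_id one alg_of_mul.
Proof. by case: ax. Qed.

Lemma alg_of_linear_l (y : A) : linear (alg_of_mul^~ y).
Proof. by move=> a x x'; rewrite /alg_of_mul tpure_linear_l linearP. Qed.

Lemma alg_of_linear_r (x : A) : linear (alg_of_mul x).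
Proof. by move=> a y y'; rewrite /alg_of_mul tpure_linear_r linearP. Qed.

Lemma alg_of_mulDl : left_distributive alg_of_mul +%R.
Proof. by move=> x x' y; have := alg_of_linear_l y 1 x x'; rewrite !scale1r. Qed.

Lemma alg_of_mulDr : right_distributive alg_of_mul +%R.
Proof. by move=> x y y'; have := alg_of_linear_r x 1 y y'; rewrite !scale1r. Qed.

Lemma alg_of_one_neq0 : (one : A) != 0.
Proof. by case: ax. Qed.

HB.instance Definition _ := GRing.Zmodule_isNzRing.Build A
  alg_of_mulA alg_of_mul1r alg_of_mulr1 alg_of_mulDl alg_of_mulDr alg_of_one_neq0.

Lemma alg_of_scaleAl (a : K) (x y : A) : a *: (x * y) = (a *: x) * y.
Proof.
have mul0 : alg_of_mul 0 y = 0 by exact: mul0r.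
have := alg_of_linear_l y a x 0; rewrite !addr0 mul0 addr0 => /esym h; exact: h.
Qed.

HB.instance Definition _ := GRing.Lmodule_isLalgebra.Build K A alg_of_scaleAl.

Lemma alg_of_scaleAr (a : K) (x y : A) : a *: (x * y) = x * (a *: y).
Proof.
have mul0 : alg_of_mul x 0 = 0 by exact: mulr0.
have := alg_of_linear_r x a y 0; rewrite !addr0 mul0 addr0 => /esym h; exact: h.
Qed.

HB.instance Definition _ := GRing.Lalgebra_isAlgebra.Build K A alg_of_scaleAr.

End AlgebraOfProduct.

Section TensorAlgebra.
Variables (K : fieldType) (V : vectType K).

(* The tensor algebra of V, realized as the free algebra on the words in the
   library's basis of V; tinj, tword, tlift and tdeg are independent of it. *)
Definition talg : Type := {malg K[{fmonom 'I_(\dim {:V})}]}.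

HB.instance Definition _ := GRing.Lalgebra.on talg.

Lemma talg_scaleAr (a : K) (x y : talg) : a *: (x * y) = x * (a *: y).
Proof.
apply/malgP => k; rewrite mcoeffZ mcoeffMl.
rewrite (mcoeffMlw _ (fsubset_refl _) (msuppZ_le a y)) mulr_sumr.
apply: eq_bigr => i _; rewrite mulr_sumr; apply: eq_bigr => j _.
by rewrite mcoeffZ mulrnAr mulrCA.
Qed.

HB.instance Definition _ := GRing.Lalgebra_isAlgebra.Build K talg talg_scaleAr.

Lemma talg_mcoeffM (x y : talg) k :
  (x * y)@_k = \sum_(k1 <- msupp x) \sum_(k2 <- msupp y)
    (x@_k1 * y@_k2) *+ (mmul k1 k2 == k).
Proof. exact: mcoeffMl. Qed.

Definition tinj (v : V) : talg :=
  \sum_(i < \dim {:V}) coord (vbasis {:V}) i v *: << fmu i >>.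

(* The pure tensor v_1 (x) ... (x) v_n. *)
Definition tword (s : seq V) : talg := \prod_(v <- s) tinj v.

(* The linear map on the tensor algebra which sends v_1 (x) ... (x) v_n to
   F [:: v_1; ...; v_n], when F is multilinear on words of each length. *)
Definition tlift (U : lmodType K) (F : seq V -> U) : talg -> U :=
  mext (fun m : {fmonom 'I_(\dim {:V})} => F [seq (vbasis {:V})`_i | i : 'I_(\dim {:V}) <- m]).

(* The component in the n-th tensor power of V. *)
Definition tdeg (n : nat) : talg -> talg :=
  mext (fun m : {fmonom 'I_(\dim {:V})} => if size m == n then << m >> : talg else 0).

Definition homogeneous (n : nat) (x : talg) : Prop := tdeg n x = x.

Lemma tlift_is_linear (U : lmodType K) (F : seq V -> U) : linear (tlift F).
Proof. exact: mext_is_linear. Qed.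

HB.instance Definition _ (U : lmodType K) (F : seq V -> U) :=
  GRing.isLinear.Build K talg U *:%R (tlift F) (tlift_is_linear F).

Lemma tdeg_is_linear n : linear (tdeg n).
Proof. exact: mext_is_linear. Qed.

HB.instance Definition _ n :=
  GRing.isLinear.Build K talg talg *:%R (tdeg n) (tdeg_is_linear n).

Lemma tinj_is_linear : linear tinj.
Proof.
move=> a v w; rewrite /tinj scaler_sumr -big_split /=; apply: eq_bigr => i _.
by rewrite linearP scalerDl scalerA.
Qed.

HB.instance Definition _ := GRing.isLinear.Build K V talg *:%R tinj tinj_is_linear.

Lemma tinj_basis (i : 'I_(\dim {:V})) : tinj (vbasis {:V})`_i = << fmu i >>.
Proof.
rewrite /tinj (bigD1 i) //= big1 => [|j ji].
  by rewrite coord_free ?eqxx ?scale1r ?addr0 //; apply/basis_free/vbasisP.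
rewrite coord_free; last exact/basis_free/vbasisP.
by rewrite eq_sym -val_eqE /= in ji *; rewrite (negbTE ji) scale0r.
Qed.

Lemma tinj_inj : injective tinj.
Proof.
move=> v w /eqP; rewrite -subr_eq0 -linearB /= => /eqP e.
apply/eqP; rewrite -subr_eq0; apply/eqP.
rewrite (coord_vbasis (memvf (v - w))) big1 // => i _.
have := congr1 (mcoeff (fmu i)) e; rewrite /tinj raddf_sum (bigD1 i) //= big1.
  by rewrite addr0 mcoeffZ mcoeffU1 eqxx mulr1 mcoeff0 => ->; rewrite scale0r.
move=> j ji; rewrite mcoeffZ mcoeffU1 -val_eqE /= !fmU eqseq_cons andbT.
by rewrite (negbTE ji) mulr0.
Qed.

Lemma word_cons (i : 'I_(\dim {:V})) (s : seq 'I_(\dim {:V})) :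
  << FMonom (i :: s) >> = << fmu i >> * << FMonom s >> :> talg.
Proof.
rewrite malgME !msuppU !oner_eq0 !big_seq_fset1 !mcoeffUU mulr1.
by congr (<< _ >>); apply/val_inj; rewrite /= fmM fmU.
Qed.


Lemma tlift_mulU (U : lmodType K) (F : seq V -> U) (i : 'I_(\dim {:V})) (y : talg) :
  tlift F (<< fmu i >> * y) = tlift (fun s => F ((vbasis {:V})`_i :: s)) y.
Proof.
rewrite [RHS]/tlift /mext malgME msuppU oner_eq0 big_seq_fset1 linear_sum /=.
apply: eq_bigr => m _; rewrite mcoeffUU mul1r.
have -> : << y@_m *g mmul (fmu i) m >> = y@_m *: << mmul (fmu i) m >> :> talg.
  by apply/malgP => k; rewrite mcoeffZ !mcoeffU mulrnAr mulr1.
by rewrite linearZ /= {1}/tlift mextU fmM fmU.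
Qed.

Lemma tlift_tword (U : lmodType K) (F : seq V -> U) (s : seq V) :
  (forall s1 s2, linear (fun v => F (s1 ++ v :: s2))) ->
  tlift F (tword s) = F s.
Proof.
elim: s F => [|v s IHs] F FL; rewrite /tword.
  by rewrite big_nil /tlift mextU fm1.
rewrite big_cons -/(tword s) /tinj mulr_suml linear_sum /=.
have FL1 : linear (fun v => F (v :: s)) by exact: (FL [::]).
pose f : {linear V -> U} := HB.pack (fun v => F (v :: s)) (GRing.isLinear.Build _ _ _ _ _ FL1).
rewrite -[RHS]/(f v) [in RHS](coord_vbasis (memvf v)) linear_sum /=.
apply: eq_bigr => i _; rewrite -scalerAl linearZ /=.
have -> c w : F (c *: w :: s) = c *: F (w :: s) by exact: (linearZ_LR f).
by congr (_ *: _); rewrite tlift_mulU IHs // => s1 s2; apply: (FL (_ :: s1)).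
Qed.

Lemma homogeneous_coef n (x : talg) (m : {fmonom 'I_(\dim {:V})}) :
  homogeneous n x -> size m != n -> x@_m = 0.
Proof.
move=> <- sm; rewrite /tdeg /mext raddf_sum big1 //= => k _.
rewrite mcoeffZ; case: eqP => [sk|_]; last by rewrite mcoeff0 mulr0.
rewrite mcoeffU1; case: eqP => [e|_]; last by rewrite mulr0.
by rewrite -e sk eqxx in sm.
Qed.

Lemma homogeneousP n (x : talg) :
  (forall m : {fmonom 'I_(\dim {:V})}, size m != n -> x@_m = 0) -> homogeneous n x.
Proof.
move=> h; rewrite /homogeneous [RHS]monalgE; apply: eq_bigr => m _.
case: eqP => [_|/eqP/h ->]; last by rewrite scale0r; apply/malgP=> k; rewrite mcoeffU mul0rn mcoeff0.
by apply/malgP => k; rewrite mcoeffZ !mcoeffU mulrnAr mulr1.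
Qed.

Lemma tword_homogeneous s : homogeneous (size s) (tword s).
Proof.
apply: homogeneousP; elim: s => [|v s IHs] m /= sm; rewrite /tword.
  by rewrite big_nil mcoeffU1; case: eqP => // e; rewrite -e fm1 in sm.
rewrite big_cons -/(tword s) /tinj mulr_suml raddf_sum big1 //= => i _.
rewrite -scalerAl mcoeffZ mcoeffMl msuppU oner_eq0 big_seq_fset1 big1 ?mulr0 // => k _.
rewrite mcoeffUU mul1r; case: eqP => // e; rewrite IHs // ?mul0rn //.
by move: sm; rewrite -e fmM fmU.
Qed.

End TensorAlgebra.

Definition generates (K : fieldType) (V : lmodType K) (B : algType K) (i : V -> B) :=
  forall S : {pred B}, GRing.subalg_closed S -> (forall v, i v \in S) -> forall x, x \in S.

(* The subspace A_1 is the image of the injective map qs_incl. *)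
Record qspace (K : fieldType) := QSpace {
  qs_alg : algType K;
  qs_gen : vectType K;
  qs_incl : {linear qs_gen -> qs_alg};
  qs_incl_inj : injective qs_incl;
  qs_generated : generates qs_incl
}.

Section PresentedQuantumSpace.
Variables (K : fieldType) (V : vectType K) (S : talg V -> Prop).

Definition low_degree_free (x : talg V) : Prop :=
  forall m : {fmonom 'I_(\dim {:V})}, (size m < 2)%N -> x@_m = 0.

Hypothesis S2 : forall x, S x -> low_degree_free x.

Lemma ideal_gen_low x : ideal_gen S x -> low_degree_free x.
Proof.
elim=> {x} [_ [a [s [b [hs ->]]]]|m hm|a x y _ hx _ hy m hm].
- move=> m hm; rewrite talg_mcoeffM big1 // => k1 _; rewrite big1 // => k2 _.
  case: eqP => [e|_]; last by rewrite mulr0n.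
  have hk1 : (size k1 < 2)%N.
    by apply: leq_ltn_trans hm; rewrite -e fmM size_cat leq_addr.
  suff -> : (a * s)@_k1 = 0 by rewrite mul0r mul0rn.
  rewrite talg_mcoeffM big1 // => k3 _; rewrite big1 // => k4 _.
  case: eqP => [e'|_]; last by rewrite mulr0n.
  rewrite (S2 hs) ?mulr0 ?mul0rn //.
  by apply: leq_ltn_trans hk1; rewrite -e' fmM size_cat leq_addl.
- by rewrite mcoeff0.
- by rewrite mcoeffD mcoeffZ hx // hy // mulr0 addr0.
Qed.

Lemma ideal_gen_proper : ~ ideal_gen S 1.
Proof.
move=> /ideal_gen_low /(_ mone); rewrite fm1 => /(_ isT).
by rewrite mcoeffU1 eqxx => /eqP; rewrite oner_eq0.
Qed.

Definition pres_alg : algType K := quot_alg ideal_gen_proper.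

Definition pres_incl (v : V) : pres_alg := aproj ideal_gen_proper (tinj v).

Lemma pres_incl_is_linear : linear pres_incl.
Proof. by move=> a v w; rewrite /pres_incl !linearP. Qed.

HB.instance Definition _ :=
  GRing.isLinear.Build K V pres_alg *:%R pres_incl pres_incl_is_linear.

Lemma pres_incl_inj : injective pres_incl.
Proof.
move=> v w /qprojP; rewrite -linearB /= => h; apply/eqP; rewrite -subr_eq0.
apply/eqP/tinj_inj; rewrite linear0; apply/malgP => m; rewrite mcoeff0.
have [hm|hm] := ltnP (size m) 2; first exact: (ideal_gen_low h).
have := tword_homogeneous [:: v - w]; rewrite /tword big_seq1.
by move/homogeneous_coef; apply; rewrite neq_ltn hm orbT.
Qed.

Lemma pres_generates : generates pres_incl.
Proof.
move=> P [P1 PL PM] Pi; elim/aprojW => x.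
have P0 : 0 \in P by have := PL (-1) _ _ P1 P1; rewrite scaleN1r addNr.
rewrite [x]monalgE linear_sum big_seq; elim/big_rec: _ => // m y _ Py.
have -> : << x@_m *g m >> = x@_m *: << m >> :> talg V.
  by apply/malgP => k; rewrite mcoeffZ !mcoeffU mulrnAr mulr1.
rewrite /= (aprojZ ideal_gen_proper x@_m (<< m >> : talg V)); apply: PL => //.
case: m => s; elim: s => [|i s IHs].
  have -> : << FMonom [::] >> = 1 :> talg V by congr (<< _ >>); apply/val_inj; rewrite /= fm1.
  exact: P1.
by rewrite word_cons aprojM; apply: PM => //; rewrite -tinj_basis; apply: Pi.
Qed.

(* The quantum space (V, T(V) / (S)). *)
Definition presented : qspace K := QSpace pres_incl_inj pres_generates.

End PresentedQuantumSpace.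

Section QuantumSpaces.
Variable K : fieldType.
Implicit Types A B : qspace K.

Definition qs_morphism A B (f : {lrmorphism qs_alg A -> qs_alg B}) : Prop :=
  forall v, exists w, f (qs_incl A v) = qs_incl B w.

Definition qs_isomorphism A B (f : {lrmorphism qs_alg A -> qs_alg B}) : Prop :=
  qs_morphism f /\
  exists g : {lrmorphism qs_alg B -> qs_alg A},
    [/\ @qs_morphism B A g, cancel f g & cancel g f].

Definition extends_to_automorphism A (sigma : 'End(qs_gen A)) : Prop :=
  exists f : {lrmorphism qs_alg A -> qs_alg A},
    @qs_isomorphism A A f /\ forall v, f (qs_incl A v) = qs_incl A (sigma v).

(* The canonical epimorphism from the tensor algebra of A_1 to A. *)
Definition qs_epi A : talg (qs_gen A) -> qs_alg A :=
  tlift (fun s => \prod_(v <- s) qs_incl A v).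

(* The degree n component I_n of the kernel of the canonical epimorphism. *)
Definition qs_rel A (n : nat) (x : talg (qs_gen A)) : Prop :=
  homogeneous n x /\ qs_epi x = 0.

Definition conic A : Prop :=
  (forall x n, @qs_epi A x = 0 -> qs_epi (tdeg n x) = 0) /\
  (forall x n, (n < 2)%N -> @qs_rel A n x -> x = 0).

End QuantumSpaces.

Section Degrees.
Variables (K : fieldType) (V W : vectType K).

Lemma tlift_homogeneous n (F : seq V -> talg W) (x : talg V) :
  homogeneous n x -> (forall s, size s = n -> homogeneous n (F s)) ->
  homogeneous n (tlift F x).
Proof.
move=> hx hF; apply: homogeneousP => m hm.
rewrite /tlift /mext raddf_sum big1 //= => k _; rewrite mcoeffZ.
have [hk|hk] := eqVneq (size k) n; last by rewrite (homogeneous_coef hx hk) mul0r.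
by rewrite (homogeneous_coef (hF _ _) hm) ?mulr0 // size_map.
Qed.

Lemma homogeneous_low n (x : talg V) :
  (2 <= n)%N -> homogeneous n x -> low_degree_free x.
Proof.
move=> n2 hx m hm; apply: (homogeneous_coef hx).
by rewrite neq_ltn (leq_trans hm n2).
Qed.

End Degrees.

Section Twist.
Variables (K : fieldType) (A : qspace K) (sigma : 'End(qs_gen A)).

(* id (x) sigma (x) sigma^2 (x) ... *)
Definition twist : talg (qs_gen A) -> talg (qs_gen A) :=
  tlift (fun s => tword (mkseq (fun i => iter i sigma s`_i) (size s))).

Variant twist_rel : talg (qs_gen A) -> Prop :=
  TwistRel n x of (2 <= n)%N & qs_rel n x : twist_rel (twist x).

Lemma twist_rel_low x : twist_rel x -> low_degree_free x.
Proof.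
case=> n {}x n2 [hx _]; apply: (homogeneous_low n2).
apply: tlift_homogeneous => // s <-.
by rewrite -{1}(size_mkseq (fun i => iter i sigma s`_i) (size s));
  apply: tword_homogeneous.
Qed.

(* A^Upsilon. The components in degrees 0 and 1 vanish when A is conic, and
   the sum of the remaining ones is already an ideal when sigma extends to an
   automorphism of A. *)
Definition upsilon : qspace K := presented twist_rel_low.

End Twist.

Section Triangle.
Variable K : fieldType.

Definition dual (V : vectType K) : vectType K := 'Hom(V, K^o).

(* The tensor product of dual V and W is realized as 'Hom(V, W). *)
Definition dual_tens (V W : vectType K) (phi : dual V) (w : W) : 'Hom(V, W) :=
  linfun (fun v => (phi v : K) *: w).

(* <phi_1 (x) ... (x) phi_n, v_1 (x) ... (x) v_n> = phi_1(v_1) ... phi_n(v_n);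
   tensor powers of different degrees are orthogonal. *)
Definition pairing (V : vectType K) (f : talg (dual V)) (x : talg V) : K :=
  tlift (fun phi : seq (dual V) => tlift (fun s : seq V =>
    (if size phi == size s then \prod_(i < size s) phi`_i s`_i else 0) : K^o) x) f.

Definition annihilator (V : vectType K) (n : nat) (J : talg V -> Prop)
    (f : talg (dual V)) : Prop :=
  homogeneous n f /\ forall x, J x -> pairing f x = 0.

(* (phi_1 (x) ... (x) phi_n) (x) (w_1 (x) ... (x) w_n) is identified with
   (phi_1 (x) w_1) (x) ... (x) (phi_n (x) w_n). *)
Definition shuffle (V W : vectType K) (f : talg (dual V)) (x : talg W) :
    talg 'Hom(V, W) :=
  tlift (fun phi : seq (dual V) => tlift (fun s : seq W =>
    tword [seq dual_tens p.1 p.2 | p <- zip phi s]) x) f.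

Variables B A : qspace K.

Variant triangle_rel : talg 'Hom(qs_gen B, qs_gen A) -> Prop :=
  TriangleRel n f x of (2 <= n)%N & annihilator n (@qs_rel _ B n) f & @qs_rel _ A n x :
    triangle_rel (shuffle f x).

Lemma triangle_rel_low x : triangle_rel x -> low_degree_free x.
Proof.
case=> n f {}x n2 [hf _] [hx _]; apply: (homogeneous_low n2).
apply: tlift_homogeneous => // phi sphi; apply: tlift_homogeneous => // s ss.
have <- : size [seq dual_tens p.1 p.2 | p <- zip phi s] = n.
  by rewrite size_map size_zip sphi ss minnn.
exact: tword_homogeneous.
Qed.

Definition triangle : qspace K := presented triangle_rel_low.

End Triangle.

Definition qend (K : fieldType) (A : qspace K) : qspace K := triangle A A.

Section Convolution.
Variable K : fieldType.

(* The coproduct of the tensor product of two coalgebras. *)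
Definition tens_coprod (C D : lmodType K) (dC : {linear C -> tens C C})
    (dD : {linear D -> tens D D}) :
    {linear tens C D -> tens (tens C D) (tens C D)} :=
  @tmiddle K C C D D \o tmap dC dD.

Definition conv (C : lmodType K) (dC : {linear C -> tens C C}) (B : algType K)
    (f g : {linear C -> B}) : {linear C -> B} :=
  @tmul K B \o tmap f g \o dC.

(* The unit as a linear map from the ground field. *)
Definition unit_map (B : algType K) (a : K^o) : B := (a : K) *: 1.

Lemma unit_map_is_linear (B : algType K) : linear (@unit_map B).
Proof. by move=> a x y; rewrite /unit_map scalerDl scalerA. Qed.

HB.instance Definition _ (B : algType K) :=
  GRing.isLinear.Build K K^o B *:%R (@unit_map B) (@unit_map_is_linear B).

End Convolution.

Section Bialgebra.
Variables (K : fieldType) (H : algType K).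
Variables (Delta : {linear H -> tens H H}) (eps : {linear H -> K^o}).

Record is_bialgebra : Prop := IsBialgebra {
  coprod_assoc : forall x, tassoc (tmap Delta idfun (Delta x)) = tmap idfun Delta (Delta x);
  counit_l : forall x, tscale_l (tmap eps idfun (Delta x)) = x;
  counit_r : forall x, tscale_r (tmap idfun eps (Delta x)) = x;
  coprod1 : Delta 1 = 1 *t 1;
  coprodM : forall x y,
    Delta (x * y) = tmap (@tmul K H) (@tmul K H) (tmiddle (Delta x *t Delta y));
  counit1 : eps 1 = 1;
  counitM : forall x y, eps (x * y) = eps x * eps y
}.

Definition coprod2 : {linear tens H H -> tens (tens H H) (tens H H)} :=
  tens_coprod Delta Delta.

Definition coprod3 :
    {linear tens (tens H H) H -> tens (tens (tens H H) H) (tens (tens H H) H)} :=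
  tens_coprod coprod2 Delta.

Definition eps2 : {linear tens H H -> K^o} := @tmul K K^o \o tmap eps eps.

Section Form.
Variable chi : {linear tens H H -> K^o}.

Definition counital_form : Prop :=
  forall x, chi (1 *t x) = eps x /\ chi (x *t 1) = eps x.

Definition chi12 : {linear tens (tens H H) H -> K^o} := @tmul K K^o \o tmap chi eps.
Definition chi23 : {linear tens (tens H H) H -> K^o} :=
  @tmul K K^o \o tmap eps chi \o @tassoc K H H H.
Definition chi_mu_id : {linear tens (tens H H) H -> K^o} :=
  chi \o tmap (@tmul K H) idfun.
Definition chi_id_mu : {linear tens (tens H H) H -> K^o} :=
  chi \o tmap idfun (@tmul K H) \o @tassoc K H H H.

Definition cocycle : Prop := conv coprod3 chi12 chi_mu_id =1 conv coprod3 chi23 chi_id_mu.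

Definition conv_inverse (chi' : {linear tens H H -> K^o}) : Prop :=
  conv coprod2 chi chi' =1 eps2 /\ conv coprod2 chi' chi =1 eps2.

(* mu_chi = chi * mu * chi^-1, forms being H-valued through the unit of H *)
Definition twisted_mul (chi' : {linear tens H H -> K^o}) : {linear tens H H -> H} :=
  @conv K _ coprod2 H (@conv K _ coprod2 H (@unit_map K H \o chi) (@tmul K H)) (@unit_map K H \o chi').

End Form.
End Bialgebra.

Section EndBialgebra.
Variables (K : fieldType) (V : vectType K) (a : (\dim {:V}).-tuple V).

Definition dual_basis (j : 'I_(\dim {:V})) : dual V := linfun (coord a j : V -> K^o).

(* z_i^j = a^j (x) a_i *)
Definition zgen (i j : 'I_(\dim {:V})) : 'Hom(V, V) :=
  dual_tens (dual_basis j) (tnth a i).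

(* sigma_i^j, where sigma(a_i) = sum_j sigma_i^j a_j *)
Definition mat_coef (s : V -> V) (i j : 'I_(\dim {:V})) : K := coord a j (s (tnth a i)).

End EndBialgebra.

Section EndStructure.
Variables (K : fieldType) (A : qspace K).
Variable a : (\dim {:qs_gen A}).-tuple (qs_gen A).

Let H : algType K := qs_alg (qend A).
Let z i j : H := qs_incl (qend A) (zgen a i j).

Definition end_bialgebra (Delta : {linear H -> tens H H}) (eps : {linear H -> K^o}) :=
  [/\ is_bialgebra Delta eps,
      forall i j, Delta (z i j) = \sum_k z i k *t z k j
    & forall i j, eps (z i j) = (i == j)%:R].

Definition associated_form (sigma : 'End(qs_gen A)) (chi : {linear tens H H -> K^o}) :=
  forall s t : seq ('I_(\dim {:qs_gen A}) * 'I_(\dim {:qs_gen A})),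
    chi ((\prod_(p <- s) z p.1 p.2) *t (\prod_(p <- t) z p.1 p.2)) =
    (\prod_(p <- s) (p.1 == p.2)%:R) *
    (\prod_(p <- t) mat_coef a (iter (size s) (sigma^-1)%VF) p.1 p.2).

End EndStructure.

Definition bialgebra_morphism (K : fieldType) (B C : algType K)
    (DeltaB : {linear B -> tens B B}) (epsB : {linear B -> K^o})
    (DeltaC : {linear C -> tens C C}) (epsC : {linear C -> K^o})
    (f : {lrmorphism B -> C}) : Prop :=
  forall x, DeltaC (f x) = tmap f f (DeltaB x) /\ epsC (f x) = epsB x.

(* Main.v *)
Require Import Defs.
From HB Require Import structures.
From mathcomp Require Import all_boot all_order all_algebra.
From mathcomp Require Import generic_quotient finmap.
From mathcomp Require Import monalg.
From mathcomp Require Import boolp reals complex.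
From mathcomp Require Import ring.

(** Let [V] be the space of generators of [A], let [H] be the algebra of
    [end[A]] and [H'] the algebra of [end[A^Upsilon]]; both are generated by
    [End(V)], realized as [V* (x) V].  Let [a] be a basis of [V] and
    [z_i^j = a^j (x) a_i].  The products [z_I^J] of entries along words [I], [J]
    of the same length span [H], and they satisfy
    [Delta z_I^J = sum_M z_I^M (x) z_M^J].  Linear identities on [H] and on its
    tensor powers are checked on these products, where they become identities
    between matrices indexed by words ([wmat_comp], [wmat_id]).

    Structure maps out of [H] come from its presentation: the relations of
    degree [n] are the tensors [f (x) x] with [x] in [I_n] and [f] in the
    annihilator of [I_n].  The coproduct is well defined because for every
    finite family of vectors there is a matrix [c] which expresses the family
    through itself and annihilates all its linear relations
    ([family_projection]): inserting [c] between the two factors of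
    [sum_M z_J^M (x) z_M^I] shows that the relations form a coideal
    ([zword_coideal]).  If a linear map [g] of [V] preserves the relations of
    [A], then [z_i^j |-> a^j (g a_i)] extends to a character of [H]
    ([character]), and composing maps corresponds to convolving characters.

    Let [rho_r] be the character given by [sigma^-r].  The form is
    [chi (x (x) y) = eps x * rho_r y] for [x] of degree [r]; the degree is
    recorded by the morphism [H -> K[X]], [z_i^j |-> delta_i^j X], which makes
    [chi] a globally defined form ([graded_form]).  On words both sides of the
    cocycle identity equal [delta_I^J * rho_n z_P^Q * rho_(n+m) z_S^T]
    ([chi_cocycle]), and replacing [sigma] by its inverse gives the convolution
    inverse of [chi].

    The twisted product is therefore [x . y = x * alpha^r y] for [x] of degree
    [r], where [alpha] conjugates the letters, [psi |-> sigma^-1 psi sigma]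
    ([twisted_mul_zword]).  The linear map
    [f (psi_0 * psi_1 * ... ) = psi_0 * alpha^-1 psi_1 * alpha^-2 psi_2 * ...]
    turns this product into the ordinary one.  It is well defined from [H] to
    [H'], with an inverse of the same shape, because
    [id (x) sigma (x) sigma^2 (x) ...] exchanges the relations of [A] and of
    [A^Upsilon] ([ker_to_twist], [twist_to_ker]).  That the twisted product is
    associative and makes [H] a bialgebra is transported from [H'] along [f]. *)

Set Implicit Arguments.
Unset Strict Implicit.
Unset Printing Implicit Defensive.
Import GRing.Theory.
Local Open Scope ring_scope.

(** * Linear maps on tensor algebras and on presented algebras *)

Section LinearCombinations.
Variable K : fieldType.

Lemma scaleDMl (B : algType K) (c : K) (x y z : B) :
  (c *: x + y) * z = c *: (x * z) + y * z.
Proof. by rewrite mulrDl scalerAl. Qed.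

Lemma scaleDMr (B : algType K) (c : K) (x y z : B) :
  z * (c *: x + y) = c *: (z * x) + z * y.
Proof. by rewrite mulrDr scalerAr. Qed.

(** The linear map with underlying function [f]. *)
Definition linear_map (U W : lmodType K) (f : U -> W) (fL : linear f) : {linear U -> W} :=
  HB.pack f (GRing.isLinear.Build K U W *:%R f fL).

(** The algebra morphism with underlying function [f]. *)
Definition algebra_map (B C : algType K) (f : B -> C) (fL : linear f)
    (fM : monoid_morphism f) : {lrmorphism B -> C} :=
  HB.pack f (GRing.isLinear.Build K B C *:%R f fL) (GRing.isMonoidMorphism.Build B C f fM).

Lemma linear0f (U W : lmodType K) (f : U -> W) : linear f -> f 0 = 0.
Proof. by move=> fL; have := fL (-1) 0 0; rewrite !scaleN1r !addNr. Qed.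

Lemma linear_sumZ (U W : lmodType K) (f : U -> W) (fL : linear f) (I : finType)
    (c : I -> K) (G : I -> U) :
  f (\sum_i c i *: G i) = \sum_i c i *: f (G i).
Proof.
rewrite -[f]/(linear_map fL : _ -> _) linear_sum.
by apply: eq_bigr => i _; rewrite linearZ.
Qed.

Lemma malg_expand (G : choiceType) (x : {malg K[G]}) :
  x = \sum_(g <- msupp x) x@_g *: << g >>.
Proof.
rewrite {1}[x]monalgE; apply: eq_bigr => g _.
by apply/malgP => k; rewrite mcoeffZ !mcoeffU mulrnAr mulr1.
Qed.

Variable V : vectType K.

Lemma tliftP (U : lmodType K) (F : seq V -> U) c (x y : talg V) :
  tlift F (c *: x + y) = c *: tlift F x + tlift F y.
Proof. exact: tlift_is_linear. Qed.

Lemma tlift0 (U : lmodType K) (F : seq V -> U) : tlift F (0 : talg V) = 0.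
Proof. exact: linear0. Qed.

Lemma talgDMl c (x y z : talg V) : (c *: x + y) * z = c *: (x * z) + y * z.
Proof. exact: scaleDMl. Qed.

Lemma talgDMr c (x y z : talg V) : z * (c *: x + y) = c *: (z * x) + z * y.
Proof. exact: scaleDMr. Qed.

End LinearCombinations.

Section TensorAlgebraInduction.
Variables (K : fieldType) (V : vectType K).
Implicit Types (x y : talg V) (s : seq V).

Lemma tword_nil : tword [::] = 1 :> talg V.
Proof. by rewrite /tword big_nil. Qed.

Lemma tword_cat s1 s2 : tword (s1 ++ s2) = tword s1 * tword s2.
Proof. exact: big_cat. Qed.

Lemma fmonom_tword (m : {fmonom 'I_(\dim {:V})}) :
  << m >> = tword [seq (vbasis {:V})`_i | i : 'I_(\dim {:V}) <- m] :> talg V.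
Proof.
case: m => s; elim: s => [|i s IHs].
  by rewrite tword_nil; congr (<< _ >>); apply/val_inj; rewrite /= fm1.
by rewrite word_cons -tinj_basis IHs /tword big_cons.
Qed.

Lemma homogeneous_ind n (P : talg V -> Prop) :
  (forall c x y, P x -> P y -> P (c *: x + y)) -> P 0 ->
  (forall s, size s = n -> P (tword s)) -> forall x, homogeneous n x -> P x.
Proof.
move=> PD P0 Pw x hx; rewrite [x](@malg_expand K).
elim/big_rec: _ => // m y _ Py; have [sm|sm] := eqVneq (size m) n.
  by apply: PD => //; rewrite fmonom_tword; apply: Pw; rewrite size_map.
by rewrite (homogeneous_coef hx sm) scale0r add0r.
Qed.

Lemma talg_ind (P : talg V -> Prop) :
  (forall c x y, P x -> P y -> P (c *: x + y)) -> P 0 ->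
  (forall s, P (tword s)) -> forall x, P x.
Proof.
move=> PD P0 Pw x; rewrite [x](@malg_expand K).
elim/big_rec: _ => // m y _ Py.
by apply: PD => //; rewrite fmonom_tword; apply: Pw.
Qed.

(** Linear maps on the tensor algebra are determined by the values at words. *)
Lemma homogeneous_eq n (U : lmodType K) (f g : talg V -> U) :
  linear f -> linear g -> (forall s, size s = n -> f (tword s) = g (tword s)) ->
  forall x, homogeneous n x -> f x = g x.
Proof.
move=> fL gL fg; apply: homogeneous_ind => [c x y fx fy||//].
  by rewrite fL gL fx fy.
by rewrite !linear0f.
Qed.

Lemma talg_eq (U : lmodType K) (f g : talg V -> U) :
  linear f -> linear g -> (forall s, f (tword s) = g (tword s)) -> f =1 g.
Proof.
move=> fL gL fg; apply: talg_ind => [c x y fx fy||//].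
  by rewrite fL gL fx fy.
by rewrite !linear0f.
Qed.

Lemma tlift_eq n (U : lmodType K) (F G : seq V -> U) x : homogeneous n x ->
  (forall s, size s = n -> F s = G s) -> tlift F x = tlift G x.
Proof.
move=> hx FG; apply: eq_bigr => m _; have [sm|sm] := eqVneq (size m) n.
  by rewrite FG ?size_map.
by rewrite (homogeneous_coef hx sm) !scale0r.
Qed.

End TensorAlgebraInduction.

Section ShiftedProducts.
Variables (K : fieldType) (V : vectType K) (B : algType K).
Variable G : nat -> {linear V -> B}.
Implicit Type s : seq V.

(** The product [G p s_0 * G (p + 1) s_1 * ...]: a product over a word in which
    the image of a letter depends on its position, shifted by [p]. *)
Definition gprod p s : B := \prod_(0 <= l < size s) G (p + l) s`_l.

Lemma gprod_nil p : gprod p [::] = 1.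
Proof. by rewrite /gprod big_geq. Qed.

Lemma gprod_cons p v s : gprod p (v :: s) = G p v * gprod p.+1 s.
Proof.
rewrite /gprod /= big_nat_recl // addn0; congr (_ * _).
by apply: eq_bigr => l _; rewrite addnS addSn.
Qed.

Lemma gprod_cat p s1 s2 : gprod p (s1 ++ s2) = gprod p s1 * gprod (p + size s1) s2.
Proof.
elim: s1 p => [|v s1 IHs] p; first by rewrite gprod_nil mul1r addn0.
by rewrite cat_cons !gprod_cons IHs mulrA addSnnS.
Qed.

Lemma gprod_linear p s1 s2 : linear (fun v => gprod p (s1 ++ v :: s2)).
Proof.
move=> c v w; rewrite !gprod_cat !gprod_cons linearP mulrDl mulrDr.
by rewrite -scalerAl -scalerAr.
Qed.

Lemma tlift_gprod p s : tlift (gprod p) (tword s) = gprod p s.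
Proof. by apply: tlift_tword => s1 s2; apply: gprod_linear. Qed.

Lemma tlift_Ml_linear (U : lmodType K) (F : seq V -> U) z :
  linear (fun x => tlift F (z * x)).
Proof. by move=> c x y; rewrite talgDMr; apply: tliftP. Qed.

Lemma tlift_Mr_linear (U : lmodType K) (F : seq V -> U) z :
  linear (fun x => tlift F (x * z)).
Proof. by move=> c x y; rewrite talgDMl; apply: tliftP. Qed.

Lemma Mtlift_linear (F : seq V -> B) b : linear (fun x => b * tlift F x).
Proof. by move=> c x y; rewrite tliftP; apply: scaleDMr. Qed.

Lemma tliftM_linear (F : seq V -> B) b : linear (fun x => tlift F x * b).
Proof. by move=> c x y; rewrite tliftP; apply: scaleDMl. Qed.

Lemma tlift_gprodMl p s y :
  tlift (gprod p) (tword s * y) = gprod p s * tlift (gprod (p + size s)) y.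
Proof.
move: y; apply: talg_eq (tlift_Ml_linear _ _) (Mtlift_linear _ _) _ => s'.
by rewrite -tword_cat !tlift_gprod gprod_cat.
Qed.

Lemma tlift_gprodMr n p x s : homogeneous n x ->
  tlift (gprod p) (x * tword s) = tlift (gprod p) x * gprod (p + n) s.
Proof.
move: x; apply: homogeneous_eq (tlift_Mr_linear _ _) (tliftM_linear _ _) _ => s' <-.
by rewrite -tword_cat !tlift_gprod gprod_cat.
Qed.

End ShiftedProducts.

Section TwistedLift.
Variables (K : fieldType) (V : vectType K) (S : talg V -> Prop).
Hypothesis S2 : forall x, S x -> low_degree_free x.
Let H := pres_alg S2.

Lemma aproj_tword s :
  aproj (ideal_gen_proper S2) (tword s) = \prod_(v <- s) pres_incl S2 v :> H.
Proof. by rewrite /tword rmorph_prod. Qed.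

Lemma pres_ind (P : H -> Prop) :
  (forall c x y, P x -> P y -> P (c *: x + y)) -> P 0 ->
  (forall s, P (\prod_(v <- s) pres_incl S2 v)) -> forall x, P x.
Proof.
move=> PD P0 Pw; elim/aprojW => x.
elim/talg_ind: x => [c x y IHx IHy||s]; first by rewrite linearP; apply: PD.
  by rewrite linear0.
by rewrite aproj_tword.
Qed.

Lemma pres_eq (U : lmodType K) (f g : H -> U) : linear f -> linear g ->
  (forall s, f (\prod_(v <- s) pres_incl S2 v) = g (\prod_(v <- s) pres_incl S2 v)) ->
  f =1 g.
Proof.
move=> fL gL fg; apply: pres_ind => [c x y fx fy||//].
  by rewrite fL gL fx fy.
by rewrite !linear0f.
Qed.

Variables (B : algType K) (G : nat -> {linear V -> B}).
Hypothesis SG : forall x, S x ->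
  exists2 n, homogeneous n x & forall p, tlift (gprod G p) x = 0.

Lemma tlift_gprod_ideal x : ideal_gen S x -> tlift (gprod G 0) x = 0.
Proof.
elim=> {x} [_ [a [x [b [/SG[n hx Gx] ->]]]]||c x y _ hx _ hy].
- have zero : linear (fun _ : talg V => 0 : B) by move=> c u v; rewrite scaler0 addr0.
  rewrite -mulrA; apply: (talg_eq (tlift_Mr_linear _ _) zero) => s.
  rewrite tlift_gprodMl; apply: etrans (mulr0 _); congr (_ * _).
  apply: (talg_eq (tlift_Ml_linear _ _) zero) => s'.
  by rewrite (tlift_gprodMr _ _ _ hx) Gx mul0r.
- exact: tlift0.
- by rewrite tliftP hx hy scaler0 addr0.
Qed.

(** Linear maps out of a presented algebra which multiply images of letters
    depending on their position. A relation can occur at any place of a word,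
    hence it has to be killed by the products starting at every position [p]. *)
Lemma twisted_lift : exists f : {linear H -> B},
  forall s, f (\prod_(v <- s) pres_incl S2 v) = gprod G 0 s.
Proof.
(* The value does not depend on the representative, by tlift_gprod_ideal. *)
pose f (x : H) : B := tlift (gprod G 0) (qrepr x).
have fE x : f (aproj (ideal_gen_proper S2) x) = tlift (gprod G 0) x.
  by apply/eqP; rewrite -subr_eq0 -linearB /= tlift_gprod_ideal //; apply: qrepr_proj.
have fL : linear f.
  by move=> c; elim/aprojW=> x; elim/aprojW=> y; rewrite -linearP !fE linearP.
exists (linear_map fL) => s /=.
by rewrite -aproj_tword fE tlift_gprod.
Qed.

End TwistedLift.

Lemma gprod_const (K : fieldType) (V : vectType K) (B : algType K)
    (g : {linear V -> B}) p s : gprod (fun=> g) p s = \prod_(v <- s) g v.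
Proof.
elim: s p => [|v s IHs] p; first by rewrite gprod_nil big_nil.
by rewrite gprod_cons big_cons IHs.
Qed.

(** A linear map which is multiplicative on words is an algebra morphism. *)
Section WordMorphism.
Variables (K : fieldType) (V : lmodType K) (H B : algType K).
Variables (i : V -> H) (g : {linear V -> B}) (f : {linear H -> B}).
Hypothesis Hind : forall (U : lmodType K) (f1 f2 : H -> U), linear f1 -> linear f2 ->
  (forall s : seq V, f1 (\prod_(v <- s) i v) = f2 (\prod_(v <- s) i v)) -> f1 =1 f2.
Hypothesis fE : forall s : seq V, f (\prod_(v <- s) i v) = \prod_(v <- s) g v.

Lemma word_morphism : monoid_morphism f.
Proof.
split; first by have := fE [::]; rewrite !big_nil.
move=> x y; move: x; apply: Hind => [c x x'|c x x'|s].
- by rewrite scaleDMl linearP.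
- by rewrite linearP scaleDMl.
move: y; apply: Hind => [c y y'|c y y'|s'].
- by rewrite scaleDMr linearP.
- by rewrite linearP scaleDMr.
by rewrite -big_cat !fE big_cat.
Qed.

End WordMorphism.

(** * Words, and projections attached to finite families *)

Section Words.
Variable K : fieldType.

(** The word of length [n] with letters [v 0], ..., [v (n - 1)]. *)
Definition letters n (V : Type) (v : 'I_n -> V) : seq V := [seq v l | l <- enum 'I_n].

Lemma size_letters n (V : Type) (v : 'I_n -> V) : size (letters v) = n.
Proof. by rewrite size_map size_enum_ord. Qed.

Lemma nth_letters n (V : Type) x0 (v : 'I_n -> V) (l : 'I_n) : nth x0 (letters v) l = v l.
Proof. by rewrite (nth_map l) ?size_enum_ord // nth_ord_enum. Qed.

Lemma letters_nth (V : Type) (x0 : V) s :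
  s = letters (fun l : 'I_(size s) => nth x0 s l).
Proof.
apply: (@eq_from_nth _ x0); first by rewrite size_letters.
by move=> l ls; rewrite -[in RHS]/(nat_of_ord (Ordinal ls)) nth_letters.
Qed.

Lemma big_letters n (B : algType K) (V : Type) (v : 'I_n -> V) (F : V -> B) :
  \prod_(u <- letters v) F u = \prod_l F (v l).
Proof. by rewrite big_map enumT [index_enum _]unlock. Qed.

Lemma gprod_letters n (V : vectType K) (B : algType K) (G : nat -> {linear V -> B}) p
    (v : 'I_n -> V) : gprod G p (letters v) = \prod_(l < n) G (p + l)%N (v l).
Proof.
rewrite /gprod size_letters big_mkord.
by apply: eq_bigr => l _; rewrite nth_letters.
Qed.

Lemma prodZ n (B : algType K) (c : 'I_n -> K) (F : 'I_n -> B) :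
  \prod_l (c l *: F l) = (\prod_l c l) *: \prod_l F l.
Proof.
elim: n c F => [|n IHn] c F; first by rewrite !big_ord0 scale1r.
by rewrite !big_ord_recl IHn -scalerAl -scalerAr scalerA.
Qed.

Lemma prod_sum n (I : finType) (B : algType K) (F : 'I_n -> I -> B) :
  \prod_l \sum_i F l i = \sum_(J : {ffun 'I_n -> I}) \prod_l F l (J l).
Proof. exact: bigA_distr_bigA. Qed.

Lemma prod_sumZ n (I : finType) (B : algType K) (c : 'I_n -> I -> K) (F : 'I_n -> I -> B) :
  \prod_l \sum_i c l i *: F l i =
  \sum_(J : {ffun 'I_n -> I}) (\prod_l c l (J l)) *: \prod_l F l (J l).
Proof. by rewrite prod_sum; apply: eq_bigr => J _; rewrite prodZ. Qed.

Lemma prod_delta n (I : eqType) (f g : {ffun 'I_n -> I}) :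
  \prod_l (f l == g l)%:R = (f == g)%:R :> K.
Proof.
have [->|fg] := eqVneq f g; first by rewrite big1 // => l _; rewrite eqxx.
have /existsP[l /negbTE fgl] : [exists l, f l != g l].
  by rewrite -negb_forall; apply: contra_neqN fg => /forallP fg; apply/ffunP => l; apply/eqP.
by rewrite (bigD1 l) //= fgl mul0r.
Qed.

Lemma sum_deltaZ (I : finType) (U : lmodType K) (i : I) (F : I -> U) :
  \sum_j (i == j)%:R *: F j = F i.
Proof.
rewrite (bigD1 i) //= eqxx scale1r big1 ?addr0 // => j ji.
by rewrite eq_sym (negbTE ji) scale0r.
Qed.

(** Coordinates of homogeneous tensors with respect to a spanning family. *)
Lemma homogeneous_coords (U : vectType K) (I : finType) (b : I -> U) n (x : talg U) :
  (forall u, exists c : I -> K, u = \sum_i c i *: b i) -> homogeneous n x ->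
  exists c : {ffun 'I_n -> I} -> K, x = \sum_J c J *: tword (letters (b \o J)).
Proof.
move=> /choice[c cE]; move: x; apply: homogeneous_ind => [k x y [cx ->] [cy ->]||s <-].
- exists (fun J => k * cx J + cy J); rewrite scaler_sumr -big_split /=.
  by apply: eq_bigr => J _; rewrite scalerDl scalerA.
- by exists (fun=> 0); rewrite big1 // => J _; rewrite scale0r.
exists (fun J => \prod_(l < size s) c s`_l (J l)).
rewrite {1}(letters_nth 0 s) /tword big_letters.
have -> : \prod_(l < size s) tinj s`_l =
    \prod_(l < size s) \sum_j c s`_l j *: tinj (b j) :> talg U.
  apply: eq_bigr => l _; rewrite {1}[s`_l]cE (raddf_sum (@tinj K U)).
  by apply: eq_bigr => j _; apply: linearZ.
by rewrite prod_sumZ; apply: eq_bigr => J _; rewrite big_letters.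
Qed.

End Words.

Section KernelOfFamily.
Variable K : fieldType.

(** A linear map [g] on a finite-dimensional space factors through an
    endomorphism [q] with the same kernel, such that [g \o q = g]. *)
Lemma kernel_projection (U : vectType K) (W : lmodType K) (g : {linear U -> W}) :
  exists q : 'End(U), (forall u, g (q u) = g u) /\ (forall u, g u = 0 -> q u = 0).
Proof.
(* The kernel as a subspace: a subspace of maximal dimension where g vanishes. *)
pose P (S : {vspace U}) := forall u, u \in S -> g u = 0.
have [S [PS Smax]] : exists S, P S /\ forall S', P S' -> (\dim S' <= \dim S)%N.
  pose Q n := `[< exists2 S : {vspace U}, P S & \dim S = n >].
  have Q0 : exists n, Q n.
    exists 0%N; apply/asboolP; exists 0%VS; last exact: dimv0.
    by move=> u; rewrite memv0 => /eqP ->; rewrite linear0.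
  have Qb n : Q n -> (n <= \dim {:U})%N.
    by move=> /asboolP[S _ <-]; apply/dimvS/subvf.
  case: (ex_maxnP Q0 Qb) => m /asboolP[S PS <-] Smax; exists S; split=> // S' PS'.
  by apply: Smax; apply/asboolP; exists S'.
have kerS u : g u = 0 -> u \in S.
  move=> gu; have PSu : P (S + <[u]>)%VS.
    move=> _ /memv_addP[v /PS gv [_ /vlineP[c ->] ->]].
    by rewrite linearD linearZ /= gv gu scaler0 addr0.
  have /eqP : S == (S + <[u]>)%VS by rewrite eqEdim addvSl Smax.
  by move=> ->; apply: (subvP (addvSr _ _)); apply: memv_line.
exists (\1 - projv S)%VF; split=> u.
  by rewrite lfunE /= id_lfunE opp_lfunE linearB /= [X in _ - X]PS ?subr0 ?memv_proj.
by move=> /kerS uS; rewrite lfunE /= id_lfunE opp_lfunE /= projv_id ?subrr.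
Qed.

(** The matrix [c] is a projection modulo the linear relations of the family
    [w]: the rows of [1 - c] are such relations, and the columns of [c]
    annihilate all of them. *)
Lemma family_projection (I : finType) (W : lmodType K) (w : I -> W) :
  exists c : I -> I -> K,
    (forall i, w i = \sum_j c i j *: w j) /\
    (forall y : I -> K, \sum_i y i *: w i = 0 -> forall j, \sum_i y i * c i j = 0).
Proof.
pose g (u : {ffun I -> K^o}) : W := \sum_i (u i : K) *: w i.
have gL : linear g.
  move=> k u v; rewrite /g scaler_sumr -big_split /=; apply: eq_bigr => i _.
  by rewrite !ffunE scalerDl scalerA.
have [q [gq kerq]] := kernel_projection (linear_map gL).
pose e i : {ffun I -> K^o} := [ffun j => (i == j)%:R].
exists (fun i j => q (e i) j); split=> [i|y yw j].
  have /= := gq (e i); rewrite /g => ->.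
  by under eq_bigr do rewrite ffunE; rewrite sum_deltaZ.
pose u : {ffun I -> K^o} := [ffun i => y i].
have -> : \sum_i y i * q (e i) j = q u j.
  have -> : u = \sum_i (y i *: e i).
    apply/ffunP => k; rewrite sum_ffunE ffunE (bigD1 k) //= big1 => [|i ik].
      by rewrite !ffunE eqxx addr0; apply/esym/mulr1.
    by rewrite !ffunE (negbTE ik) scaler0.
  rewrite linear_sum sum_ffunE; apply: eq_bigr => i _.
  by rewrite linearZ /= ffunE.
rewrite (kerq u) ?ffunE //= /g -[RHS]yw; apply: eq_bigr => i _; by rewrite ffunE.
Qed.

End KernelOfFamily.

(** * The relations of the algebra of quantum endomorphisms in coordinates *)

Section BilinearLift.
Variables (K : fieldType) (U V : vectType K) (B : algType K).
Variables (F : seq U -> seq V -> B) (D : U -> V -> B).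
Hypotheses (Dl : forall v, linear (D^~ v)) (Dr : forall u, linear (D u)).
Variable n : nat.
Hypothesis FD : forall s t, size s = n -> size t = n ->
  F s t = \prod_(0 <= l < n) D s`_l t`_l.

(** The bilinear map which is [F] on pairs of words. It is used only where [F]
    is multilinear on words of the common length [n]. *)
Definition bilift (x : talg U) (y : talg V) : B := tlift (fun s => tlift (F s) y) x.

Lemma bilift_tword s t : size s = n -> size t = n ->
  bilift (tword s) (tword t) = \prod_(0 <= l < n) D s`_l t`_l.
Proof.
move=> ss st; rewrite /bilift.
pose Gt l := linear_map (Dl t`_l); pose Gs s' l := linear_map (Dr (s' : seq U)`_l).
rewrite (@tlift_eq _ _ (size s) _ _ (gprod Gt 0) _ (tword_homogeneous s)).
  by rewrite tlift_gprod /gprod ss.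
rewrite ss => s' ss'.
rewrite (@tlift_eq _ _ (size t) _ _ (gprod (Gs s') 0) _ (tword_homogeneous t)).
  by rewrite tlift_gprod /gprod ss' st.
by rewrite st => t' st'; rewrite FD // /gprod st'.
Qed.

Lemma bilift_linear_l y : linear (bilift^~ y).
Proof. exact: (@tlift_is_linear K U B (fun s => tlift (F s) y)). Qed.

Lemma bilift_linear_r x : linear (bilift x).
Proof.
move=> c y y'; rewrite /bilift /tlift /mext scaler_sumr -big_split /=.
apply: eq_bigr => m _; rewrite [X in _ *: X]tliftP scalerDr !scalerA.
by rewrite [c * _]mulrC.
Qed.

Lemma bilift_coords (I J : finType) (f : {ffun 'I_n -> I} -> K)
    (x : {ffun 'I_n -> J} -> K) (b : I -> U) (a : J -> V) :
  bilift (\sum_s f s *: tword (letters (b \o s))) (\sum_t x t *: tword (letters (a \o t)))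
  = \sum_s \sum_t (f s * x t) *: \prod_l D (b (s l)) (a (t l)).
Proof.
rewrite (linear_sumZ (bilift_linear_l _)); apply: eq_bigr => s _.
rewrite (linear_sumZ (bilift_linear_r _)) scaler_sumr; apply: eq_bigr => t _.
rewrite scalerA bilift_tword ?size_letters // big_mkord; congr (_ *: _).
by apply: eq_bigr => l _; rewrite !nth_letters.
Qed.

End BilinearLift.

Section TriangleCoordinates.
Variables (K : fieldType) (V : vectType K).
Local Notation d := (\dim {:V}).
Variable a : d.-tuple V.
Hypothesis aP : basis_of {:V} a.

(** Multi-indices of length [n] for the basis [a]. *)
Definition word n := {ffun 'I_n -> 'I_d}.

Lemma coord_sum v : v = \sum_i coord a i v *: tnth a i.
Proof.
rewrite {1}(coord_basis aP (memvf v)); apply: eq_bigr => i _.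
by rewrite (tnth_nth 0).
Qed.

Lemma coord_tnth i j : coord a i (tnth a j) = (i == j)%:R.
Proof. by rewrite (tnth_nth 0) coord_free ?(basis_free aP) // eq_sym. Qed.

Lemma dual_basisE j v : dual_basis a j v = coord a j v.
Proof.
have cL : linear (coord a j : V -> K^o) by move=> c u w; rewrite linearP.
exact: (lfunE (linear_map cL)).
Qed.

Lemma dual_sum (phi : dual V) : phi = \sum_i (phi (tnth a i) : K) *: dual_basis a i.
Proof.
apply/lfunP => v; rewrite sum_lfunE [in LHS](coord_sum v) linear_sum.
apply: eq_bigr => i _; rewrite linearZ scale_lfunE dual_basisE.
exact: mulrC.
Qed.

Lemma dual_tensE (W : vectType K) (phi : dual V) (w : W) v :
  dual_tens phi w v = (phi v : K) *: w.
Proof.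
have L : linear (fun v => (phi v : K) *: w).
  by move=> c u u'; rewrite linearP scalerDl scalerA.
exact: (lfunE (linear_map L)).
Qed.

Lemma dual_tens_linear_l (W : vectType K) (w : W) : linear (fun phi : dual V => dual_tens phi w).
Proof.
move=> c phi psi; apply/lfunP => v.
rewrite add_lfunE scale_lfunE !dual_tensE add_lfunE scale_lfunE scalerDl.
by rewrite -[_ *: phi v]/(c * phi v) -scalerA.
Qed.

Lemma dual_tens_linear_r (W : vectType K) (phi : dual V) :
  linear (fun w : W => dual_tens phi w).
Proof.
move=> c w w'; apply/lfunP => v.
by rewrite add_lfunE scale_lfunE !dual_tensE scalerDr !scalerA mulrC.
Qed.

Lemma zgen_sum (psi : 'Hom(V, V)) :
  psi = \sum_i dual_tens (dual_basis a i) (psi (tnth a i)).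
Proof.
apply/lfunP => v; rewrite sum_lfunE [in LHS](coord_sum v) linear_sum.
by apply: eq_bigr => i _; rewrite linearZ dual_tensE dual_basisE.
Qed.

Lemma homogeneous_lin (U : vectType K) n (I : finType) (c : I -> K) (x : I -> talg U) :
  (forall i, homogeneous n (x i)) -> homogeneous n (\sum_i c i *: x i).
Proof.
move=> hx; rewrite /homogeneous (linear_sumZ (@tdeg_is_linear K U n)).
by apply: eq_bigr => i _; rewrite hx.
Qed.

Lemma homogeneous_letters (U : vectType K) n (v : 'I_n -> U) :
  homogeneous n (tword (letters v)).
Proof. by have := tword_homogeneous (letters v); rewrite size_letters. Qed.

(** [x] is the family of coordinates of a tensor of degree [n] which is sent to
    zero by the morphism extending [i] to the tensor algebra. *)
Definition ker_of (B : algType K) (i : V -> B) n (x : word n -> K) : Prop :=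
  \sum_J x J *: \prod_l i (tnth a (J l)) = 0.

(** Coordinates of the tensors of degree [n] over the dual space which
    annihilate [R]. *)
Definition perp n (R : (word n -> K) -> Prop) (f : word n -> K) : Prop :=
  forall x, R x -> \sum_J f J * x J = 0.

(** The element of [B] with coordinates [f] and [x], where [G l] gives the
    images of the generators in position [l]. *)
Definition rel_value (B : algType K) n (G : nat -> 'Hom(V, V) -> B) (f x : word n -> K) : B :=
  \sum_I \sum_J (f I * x J) *: \prod_(l < n) G l (zgen a (J l) (I l)).

(** [H] is presented by [i] through the relations with coordinates [f], [x],
    where [x] satisfies [R] and [f] annihilates [R]. Only these three properties
    of the algebra of quantum endomorphisms are used: the words span it, the
    relations hold, and position-dependent products which respect the
    relations, shifted by any [p], define linear maps. *)
Definition end_presentation (R : forall n, (word n -> K) -> Prop) (H : algType K)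
    (i : {linear 'Hom(V, V) -> H}) : Prop :=
  [/\ forall (U : lmodType K) (f1 f2 : H -> U), linear f1 -> linear f2 ->
        (forall s, f1 (\prod_(v <- s) i v) = f2 (\prod_(v <- s) i v)) -> f1 =1 f2,
      forall n (f x : word n -> K), (2 <= n)%N -> R n x -> perp (@R n) f ->
        rel_value (fun=> i) f x = 0
    & forall (B : algType K) (G : nat -> {linear 'Hom(V, V) -> B}),
        (forall n p (f x : word n -> K), (2 <= n)%N -> R n x -> perp (@R n) f ->
          rel_value (fun l => G (p + l)%N) f x = 0) ->
        exists theta : {linear H -> B},
          forall s, theta (\prod_(v <- s) i v) = gprod G 0 s].

End TriangleCoordinates.

Section TrianglePresentation.
Variables (K : fieldType) (A : qspace K).
Local Notation V := (qs_gen A).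
Local Notation d := (\dim {:V}).
Variable a : d.-tuple V.
Hypothesis aP : basis_of {:V} a.
Local Notation avec n x := (\sum_(J : word V n) x J *: tword (letters (tnth a \o J))).
Local Notation fvec n f := (\sum_(I : word V n) f I *: tword (letters (dual_basis a \o I))).

Lemma qs_epi_coords n (x : word V n -> K) :
  qs_epi (avec n x) = \sum_J x J *: \prod_l qs_incl A (tnth a (J l)).
Proof.
rewrite [LHS](linear_sumZ (@tlift_is_linear K V _ _)).
apply: eq_bigr => J _; congr (_ *: _).
rewrite (@tlift_eq _ _ n _ _ (gprod (fun=> qs_incl A) 0)); last by move=> s _; rewrite gprod_const.
  by rewrite tlift_gprod gprod_const big_letters.
exact: homogeneous_letters.
Qed.

Lemma qs_rel_coords n (x : talg V) : qs_rel n x ->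
  exists2 c : word V n -> K, x = avec n c & ker_of a (qs_incl A) c.
Proof.
case=> hx; have [|c xE] := @homogeneous_coords K V _ (tnth a) n x _ hx.
  by move=> v; exists (fun i => coord a i v); apply: coord_sum.
by rewrite xE => ex; exists c => //; rewrite /ker_of -qs_epi_coords.
Qed.

Lemma coords_qs_rel n (c : word V n -> K) :
  ker_of a (qs_incl A) c -> qs_rel n (avec n c).
Proof.
move=> kc; split; last by rewrite qs_epi_coords.
by apply: homogeneous_lin => J; apply: homogeneous_letters.
Qed.

Lemma pairing_coords n (f x : word V n -> K) :
  pairing (fvec n f) (avec n x) = \sum_J f J * x J.
Proof.
have evalL (v : V) : linear (fun phi : dual V => phi v).
  by move=> c phi psi; rewrite add_lfunE scale_lfunE.
pose F (phi : seq (dual V)) (s : seq V) : K^o :=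
  if size phi == size s then \prod_(i < size s) phi`_i s`_i else 0.
rewrite -[LHS]/(bilift F _ _).
rewrite (@bilift_coords K _ _ K^o F (fun (phi : dual V) (v : V) => phi v) evalL _ n) //=.
- apply: eq_bigr => I _; rewrite (bigD1 I) //= [X in _ + X]big1 => [|J JI].
    rewrite big1 => [|l _]; last by rewrite dual_basisE (coord_tnth aP) eqxx.
    by rewrite addr0; apply: mulr1.
  have -> : \prod_l dual_basis a (I l) (tnth a (J l)) = (I == J)%:R :> K.
    by rewrite -prod_delta; apply: eq_bigr => l _; rewrite dual_basisE (coord_tnth aP).
  by rewrite eq_sym (negbTE JI) scaler0.
- by move=> phi c u v; rewrite linearP.
- by move=> phi s sphi ss; rewrite /F sphi ss eqxx big_mkord.
Qed.

Lemma shuffle_coords n (f x : word V n -> K) :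
  shuffle (fvec n f) (avec n x) = rel_value a (fun=> @tinj K 'Hom(V, V)) f x.
Proof.
pose F (phi : seq (dual V)) (s : seq V) : talg 'Hom(V, V) :=
  tword [seq dual_tens p.1 p.2 | p <- zip phi s].
rewrite -[LHS]/(bilift F _ _).
apply: (@bilift_coords K _ _ (talg 'Hom(V, V)) F (fun (phi : dual V) (v : V) => tinj (dual_tens phi v))).
- by move=> v c phi psi; rewrite dual_tens_linear_l; apply: tinj_is_linear.
- by move=> phi c u v; rewrite dual_tens_linear_r; apply: tinj_is_linear.
move=> phi s sphi ss; rewrite /F /tword big_map.
rewrite (big_nth (0, 0)) size_zip sphi ss minnn; apply: eq_big_nat => l /andP[_ ln].
by rewrite nth_zip ?sphi ?ss.
Qed.

Lemma triangle_rel_coords y : @triangle_rel K A A y ->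
  exists n (f x : word V n -> K), [/\ (2 <= n)%N, ker_of a (qs_incl A) x,
    perp (@ker_of _ _ a _ (qs_incl A) n) f
    & y = rel_value a (fun=> @tinj K 'Hom(V, V)) f x].
Proof.
case=> n f x n2 [hf fx] /qs_rel_coords[cx -> kx].
have [|cf fE] := @homogeneous_coords K (dual V) _ (dual_basis a) n f _ hf.
  by move=> phi; exists (fun i => (phi (tnth a i) : K)); apply: dual_sum.
exists n, cf, cx; split=> //; last by rewrite fE shuffle_coords.
by move=> c /coords_qs_rel/fx; rewrite fE pairing_coords.
Qed.

Lemma coords_triangle_rel n (f x : word V n -> K) : (2 <= n)%N ->
  ker_of a (qs_incl A) x -> perp (@ker_of _ _ a _ (qs_incl A) n) f ->
  @triangle_rel K A A (rel_value a (fun=> @tinj K 'Hom(V, V)) f x).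
Proof.
move=> n2 kx pf; rewrite -shuffle_coords; apply: (@TriangleRel _ _ _ n) => //.
  split; first by apply: homogeneous_lin => J; apply: homogeneous_letters.
  by move=> y /qs_rel_coords[c -> kc]; rewrite pairing_coords pf.
exact: coords_qs_rel.
Qed.

Lemma rel_value_map n (B C : algType K) (h : {lrmorphism B -> C})
    (G : nat -> 'Hom(V, V) -> B) (f x : word V n -> K) :
  h (rel_value a G f x) = rel_value a (fun l v => h (G l v)) f x.
Proof.
rewrite linear_sum; apply: eq_bigr => I _; rewrite linear_sum; apply: eq_bigr => J _.
by rewrite linearZ_LR rmorph_prod.
Qed.

Lemma tlift_rel_value n (B : algType K) (G : nat -> {linear 'Hom(V, V) -> B}) p
    (f x : word V n -> K) :
  tlift (gprod G p) (rel_value a (fun=> @tinj K 'Hom(V, V)) f x) =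
  rel_value a (fun l => G (p + l)%N) f x.
Proof.
rewrite /rel_value.
rewrite -[LHS]/(linear_map (@tlift_is_linear K _ _ (gprod G p)) _) linear_sum.
apply: eq_bigr => I _; rewrite linear_sumZ; last exact: tlift_is_linear.
apply: eq_bigr => J _; congr (_ *: _).
rewrite -(big_letters (fun l => zgen a (J l) (I l))) [LHS]tlift_gprod.
by rewrite gprod_letters.
Qed.

Lemma rel_value_homogeneous n (f x : word V n -> K) :
  homogeneous n (rel_value a (fun=> @tinj K 'Hom(V, V)) f x).
Proof.
rewrite /rel_value.
under eq_bigr do under eq_bigr do rewrite -big_letters.
rewrite pair_big /=; apply: (@homogeneous_lin _ _ _ _ (fun p => f p.1 * x p.2)) => p.
exact: homogeneous_letters.
Qed.

(** The algebra of quantum endomorphisms of [A], the relations being the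
    coordinates of the kernel of the canonical epimorphism. *)
Lemma qend_presentation :
  @end_presentation _ _ a (@ker_of _ _ a _ (qs_incl A)) (qs_alg (qend A)) (qs_incl (qend A)).
Proof.
split.
- exact: (@pres_eq _ _ _ (@triangle_rel_low K A A)).
- move=> n f x n2 kx pf; have := coords_triangle_rel n2 kx pf.
  move=> /(@ideal_gen_in _ _ _)/lspanN; set y := rel_value _ _ _ _ => hy.
  have : aproj (ideal_gen_proper (@triangle_rel_low K A A)) y = 0.
    rewrite -(linear0 (aproj (ideal_gen_proper (@triangle_rel_low K A A)))).
    by apply/esym/qprojP; rewrite sub0r.
  by rewrite /y rel_value_map.
- move=> B G GP; apply: twisted_lift => y /triangle_rel_coords[n [f [x [n2 kx pf ->]]]].
  exists n => [|p]; first exact: rel_value_homogeneous.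
  by rewrite tlift_rel_value; apply: GP.
Qed.

End TrianglePresentation.

(** * Evaluation on pure tensors, and tensor products of algebras *)

Section TensorEvaluation.
Variable K : fieldType.
Implicit Types U V W X Y : lmodType K.

(** Linear maps on a tensor product are determined by the pure tensors. *)
Lemma tens_eq V W U (f g : tens V W -> U) : linear f -> linear g ->
  (forall v w, f (v *t w) = g (v *t w)) -> f =1 g.
Proof.
move=> fL gL fg; elim/qprojW=> x.
rewrite [x]malg_expand.
rewrite linear_sum -[f]/(linear_map fL : _ -> _) -[g]/(linear_map gL : _ -> _) !linear_sum.
by apply: eq_bigr => -[v w] _; rewrite !linearZ /=; congr (_ *: _); apply: fg.
Qed.

Lemma tpure_suml V W (I : finType) (v : I -> V) (w : W) :
  (\sum_i v i) *t w = \sum_i v i *t w.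
Proof. by rewrite -[LHS]/(linear_map (tpure_linear_l w) _) linear_sum. Qed.

Lemma tpure_sumr V W (I : finType) (v : V) (w : I -> W) :
  v *t (\sum_i w i) = \sum_i v *t w i.
Proof. by rewrite -[LHS]/(linear_map (tpure_linear_r v) _) linear_sum. Qed.

Lemma tpureZl V W (c : K) (v : V) (w : W) : (c *: v) *t w = c *: (v *t w).
Proof. by rewrite -[LHS]/(linear_map (tpure_linear_l w) _) linearZ. Qed.

Lemma tpureZr V W (c : K) (v : V) (w : W) : v *t (c *: w) = c *: (v *t w).
Proof. by rewrite -[LHS]/(linear_map (tpure_linear_r v) _) linearZ. Qed.

Lemma tpure0l V W (w : W) : (0 : V) *t w = 0.
Proof. by rewrite -[LHS]/(linear_map (tpure_linear_l w) _) linear0. Qed.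

Lemma tmapE V V' W W' (f : {linear V -> W}) (g : {linear V' -> W'}) v v' :
  tmap f g (v *t v') = f v *t g v'.
Proof.
apply: tens_liftE => [w|u] c x y; rewrite linearP.
  exact: tpure_linear_l.
exact: tpure_linear_r.
Qed.

Lemma tassocE U V W (u : U) (v : V) (w : W) : tassoc ((u *t v) *t w) = u *t (v *t w).
Proof.
have L t : linear (fun w : W => tens_lift (fun (u : U) (v : V) => u *t (v *t w)) t).
  by apply: tens_lift_param => {}u {}v c x y; rewrite !tpure_linear_r.
have L' w' : linear (fun t => tens_lift (fun (u : U) (v : V) => u *t (v *t (w' : W))) t).
  apply: tens_lift_linear => [{}v|{}u] c x y; first by rewrite tpure_linear_l.
  by rewrite tpure_linear_l tpure_linear_r.
rewrite /tassoc tens_liftE // tens_liftE // => [{}v|{}u] c x y.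
  by rewrite tpure_linear_l.
by rewrite tpure_linear_l tpure_linear_r.
Qed.

Lemma tmiddleE U V W X (u : U) (v : V) (w : W) (x : X) :
  tmiddle ((u *t v) *t (w *t x)) = (u *t w) *t (v *t x).
Proof.
have L2 (u' : U) (v' : V) :
    linear (tens_lift (fun (w : W) (x : X) => (u' *t w) *t (v' *t x))).
  apply: tens_lift_linear => [y|y] c p q.
    by rewrite tpure_linear_r tpure_linear_l.
  by rewrite !tpure_linear_r.
have Lu t (v' : V) : linear (fun u' : U =>
    tens_lift (fun (w : W) (x : X) => (u' *t w) *t (v' *t x)) t).
  by apply: tens_lift_param => w' x' c p q; rewrite !tpure_linear_l.
have Lv t (u' : U) : linear (fun v' : V =>
    tens_lift (fun (w : W) (x : X) => (u' *t w) *t (v' *t x)) t).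
  by apply: tens_lift_param => w' x' c p q; rewrite tpure_linear_l tpure_linear_r.
rewrite /tmiddle tens_liftE => [|t|s].
- rewrite tens_liftE; [|exact: Lu|exact: Lv].
  rewrite tens_liftE // => [y|y] c p q; first by rewrite tpure_linear_r tpure_linear_l.
  by rewrite !tpure_linear_r.
- by apply: tens_lift_linear => [v'|u']; [apply: Lu | apply: Lv].
- by apply: tens_lift_param => u' v'; apply: L2.
Qed.

Lemma tmulE (B : algType K) (x y : B) : tmul (x *t y) = x * y.
Proof.
apply: tens_liftE => [b|b] c p q; first by rewrite mulrDl scalerAl.
by rewrite mulrDr scalerAr.
Qed.

Lemma tscale_lE V (c : K^o) (v : V) : tscale_l (c *t v) = (c : K) *: v.
Proof.
apply: (tens_liftE (F := fun (c : K^o) (v : V) => (c : K) *: v)) => [w|b] k x y.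
  by rewrite scalerDl scalerA.
by rewrite scalerDr !scalerA mulrC.
Qed.

Lemma tscale_rE V (c : K^o) (v : V) : tscale_r (v *t c) = (c : K) *: v.
Proof.
apply: (tens_liftE (F := fun (v : V) (c : K^o) => (c : K) *: v)) => [b|w] k x y.
  by rewrite scalerDr !scalerA mulrC.
by rewrite scalerDl scalerA.
Qed.

End TensorEvaluation.

Section TensorLinearity.
Variables (K : fieldType) (M : lmodType K) (U : lmodType K).
Variables (mul : {linear tens M M -> M}) (f : {linear tens M M -> U}).

Lemma tens_linear_l y : linear (fun x => f (x *t y)).
Proof. by move=> k x x'; rewrite tpure_linear_l linearP. Qed.

Lemma tens_linear_r x : linear (fun y => f (x *t y)).
Proof. by move=> k y y'; rewrite tpure_linear_r linearP. Qed.

Lemma tens_linear_rl x z : linear (fun y => f (x *t mul (y *t z))).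
Proof. by move=> k y y'; rewrite tpure_linear_l linearP tpure_linear_r linearP. Qed.

Lemma tens_linear_rr x y : linear (fun z => f (x *t mul (y *t z))).
Proof. by move=> k z z'; rewrite tpure_linear_r linearP tpure_linear_r linearP. Qed.

Lemma tens_linear_ll y z : linear (fun x => f (mul (x *t y) *t z)).
Proof. by move=> k x x'; rewrite tpure_linear_l linearP tpure_linear_l linearP. Qed.

Lemma tens_linear_lr x z : linear (fun y => f (mul (x *t y) *t z)).
Proof. by move=> k y y'; rewrite tpure_linear_r linearP tpure_linear_l linearP. Qed.

End TensorLinearity.

Section TensorProductAlgebra.
Variables (K : fieldType) (B C : algType K).

(** The product of the algebra [B (x) C]. *)
Definition tens_mul : {linear tens (tens B C) (tens B C) -> tens B C} :=
  tmap (@tmul K B) (@tmul K C) \o @tmiddle K B C B C.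

Lemma tens_mulE (b b' : B) (c c' : C) :
  tens_mul ((b *t c) *t (b' *t c')) = (b * b') *t (c * c').
Proof. by rewrite /tens_mul /= tmiddleE tmapE /= !tmulE. Qed.

(** Nonvanishing of the unit is a hypothesis, since it cannot be read off the
    definition of the tensor product. *)
Lemma tens_algebra_axioms : 1 *t 1 != 0 :> tens B C ->
  algebra_axioms tens_mul ((1 : B) *t (1 : C)).
Proof.
move=> one_neq0.
have idL : linear (fun x : tens B C => x) by [].
split; [move=> x y z|move=> x|move=> x|exact: one_neq0].
- move: x; apply: tens_eq; [exact: tens_linear_l|exact: tens_linear_ll|move=> b c].
  move: y; apply: tens_eq; [exact: tens_linear_rl|exact: tens_linear_lr|move=> b' c'].
  move: z; apply: tens_eq; [exact: tens_linear_rr|exact: tens_linear_r|move=> b'' c''].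
  rewrite [X in _ *t X]tens_mulE [LHS]tens_mulE.
  by rewrite [X in _ = tens_mul (X *t _)]tens_mulE [RHS]tens_mulE !mulrA.
- move: x; apply: tens_eq; [exact: tens_linear_r|exact: idL|move=> b c].
  by rewrite tens_mulE !mul1r.
- move: x; apply: tens_eq; [exact: tens_linear_l|exact: idL|move=> b c].
  by rewrite tens_mulE !mulr1.
Qed.

Lemma tens_prod (ax : algebra_axioms tens_mul ((1 : B) *t (1 : C))) n
    (b : 'I_n -> B) (c : 'I_n -> C) :
  \prod_l (b l *t c l : alg_of ax) = (\prod_l b l) *t (\prod_l c l).
Proof.
elim: n b c => [|n IHn] b c; first by rewrite !big_ord0.
by rewrite !big_ord_recl IHn [LHS]tens_mulE.
Qed.

End TensorProductAlgebra.

(** * The matrix coalgebras spanning the algebra of quantum endomorphisms *)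

Section MatrixCoalgebra.
Variables (K : fieldType) (V : vectType K).
Local Notation d := (\dim {:V}).
Variable a : d.-tuple V.
Hypothesis aP : basis_of {:V} a.
Local Notation word := (word V).

(** The entry [z_k^l] of [psi] has the coefficient of [a_k] in [psi a_l]. *)
Lemma zgen_coords (psi : 'Hom(V, V)) :
  psi = \sum_(p : 'I_d * 'I_d) coord a p.1 (psi (tnth a p.2)) *: zgen a p.1 p.2.
Proof.
rewrite {1}(zgen_sum aP psi) -(pair_bigA _ (fun k l => coord a k (psi (tnth a l)) *: zgen a k l)) /=.
rewrite exchange_big; apply: eq_bigr => l _ /=.
rewrite [in LHS](coord_sum aP (psi (tnth a l))) -[LHS]/(linear_map (dual_tens_linear_r _) _) linear_sum.
by apply: eq_bigr => k _; rewrite linearZ.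
Qed.

Lemma zgenE k l m : zgen a k l (tnth a m) = (l == m)%:R *: tnth a k.
Proof. by rewrite /zgen dual_tensE dual_basisE (coord_tnth aP). Qed.

Lemma sum_delta (I : finType) (i : I) (F : I -> K) : \sum_j (i == j)%:R * F j = F i.
Proof. exact: (@sum_deltaZ K I K^o). Qed.

Section Trace.
Variables (U : lmodType K) (D : V -> dual V -> U).

(** The linear map on [V* (x) V] given by a bilinear map. *)
Definition hom_lift (psi : 'Hom(V, V)) : U :=
  \sum_m D (psi (tnth a m)) (dual_basis a m).

Hypotheses (Dl : forall phi, linear (D^~ phi)) (Dr : forall v, linear (D v)).

Lemma hom_lift_linear : linear hom_lift.
Proof.
move=> c u v; rewrite /hom_lift scaler_sumr -big_split; apply: eq_bigr => m _ /=.
by rewrite add_lfunE scale_lfunE Dl.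
Qed.

Lemma hom_liftE phi v : hom_lift (dual_tens phi v) = D v phi.
Proof.
rewrite [in RHS](dual_sum aP phi) -[RHS]/(linear_map (Dr v) _) linear_sum.
apply: eq_bigr => m _; rewrite linearZ /= dual_tensE.
by rewrite -[LHS]/(linear_map (Dl _) _) linearZ.
Qed.

End Trace.

(** The matrix, indexed by words, of [F 0 (x) ... (x) F (n - 1)]. *)
Definition wmat n (F : nat -> 'End(V)) (I J : word n) : K :=
  \prod_(l < n) coord a (J l) (F l (tnth a (I l))).

Lemma wmat_comp n (F F' : nat -> 'End(V)) (I J : word n) :
  \sum_M wmat F I M * wmat F' M J = wmat (fun l => F' l \o F l)%VF I J.
Proof.
transitivity (\sum_(M : word n) \prod_(l < n)
    (coord a (M l) (F l (tnth a (I l))) * coord a (J l) (F' l (tnth a (M l))))).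
  by apply: eq_bigr => M _; rewrite big_split.
rewrite -(prod_sum (B := K^o) (fun l k =>
  coord a k (F l (tnth a (I l))) * coord a (J l) (F' l (tnth a k)))).
apply: eq_bigr => l _; rewrite comp_lfunE [in RHS](coord_sum aP (F l (tnth a (I l)))).
by rewrite !linear_sum; apply: eq_bigr => k _; rewrite !linearZ.
Qed.

Lemma wmat_id n (F : nat -> 'End(V)) (I J : word n) :
  (forall l, F l = \1%VF) -> wmat F I J = (I == J)%:R.
Proof.
move=> F1; rewrite eq_sym -prod_delta.
by apply: eq_bigr => l _; rewrite F1 id_lfunE (coord_tnth aP).
Qed.

(** The action of [G 0 (x) ... (x) G (n - 1)] on coordinates of tensors. *)
Definition act n (G : nat -> 'End(V)) (x : word n -> K) (I : word n) : K :=
  \sum_J x J * wmat G J I.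

(** The transposed action, on coordinates over the dual space. *)
Definition coact n (G : nat -> 'End(V)) (f : word n -> K) (I : word n) : K :=
  \sum_J f J * wmat G I J.

Lemma act_id n (x : word n -> K) : act (fun=> \1%VF) x = x.
Proof.
apply/funext => I; rewrite /act -[RHS](sum_delta I x); apply: eq_bigr => J _.
by rewrite wmat_id // mulrC eq_sym.
Qed.

Lemma coact_act n (G : nat -> 'End(V)) (f y : word n -> K) :
  \sum_I coact G f I * y I = \sum_J f J * act G y J.
Proof.
rewrite /coact /act; under eq_bigr => I _ do rewrite mulr_suml.
rewrite exchange_big; apply: eq_bigr => J _ /=; rewrite mulr_sumr.
by apply: eq_bigr => I _; rewrite mulrAC mulrA.
Qed.

(** Acting on the coordinates amounts to applying [G l] to the letter in
    position [l]. *)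
Lemma act_value n (C : algType K) (u : nat -> {linear V -> C}) (G : nat -> 'End(V))
    (x : word n -> K) :
  \sum_I act G x I *: \prod_(l < n) u l (tnth a (I l)) =
  \sum_J x J *: \prod_(l < n) u l (G l (tnth a (J l))).
Proof.
transitivity (\sum_J \sum_(I : word n) (x J * wmat G J I) *:
    \prod_(l < n) u l (tnth a (I l))).
  by rewrite exchange_big; apply: eq_bigr => I _; rewrite /act scaler_suml.
apply: eq_bigr => J _; transitivity (x J *: \prod_(l < n)
    \sum_k coord a k (G l (tnth a (J l))) *: u l (tnth a k)).
  by rewrite prod_sumZ scaler_sumr; apply: eq_bigr => I _; rewrite scalerA.
congr (_ *: _); apply: eq_bigr => l _.
rewrite [in RHS](coord_sum aP (G l (tnth a (J l)))) linear_sum.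
by apply: eq_bigr => k _; rewrite linearZ.
Qed.

Variables (B : algType K) (j : V -> B).
Local Notation R := (fun n => @ker_of K V a B j n).
Variables (H : algType K) (i : {linear 'Hom(V, V) -> H}).
Hypothesis pres : end_presentation a R i.

(** The entries of the matrix coalgebras which span [H]. *)
Definition zword n (I J : word n) : H := \prod_l i (zgen a (I l) (J l)).

(** The products of entries span [H]. *)
Lemma zword_eq (U : lmodType K) (f1 f2 : H -> U) : linear f1 -> linear f2 ->
  (forall n (I J : word n), f1 (zword I J) = f2 (zword I J)) -> f1 =1 f2.
Proof.
move=> f1L f2L f12; case: pres => Hind _ _; apply: Hind => // s.
have -> : \prod_(v <- s) i v = \sum_(J : {ffun 'I_(size s) -> 'I_d * 'I_d})
    (\prod_(l < size s) coord a (J l).1 (s`_l (tnth a (J l).2))) *: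
      zword [ffun l => (J l).1] [ffun l => (J l).2].
  rewrite {1}(letters_nth 0 s) big_letters.
  under eq_bigr => l _ do rewrite (zgen_coords s`_l) linear_sum.
  under eq_bigr => l _ do under eq_bigr => p _ do rewrite linearZ /=.
  rewrite prod_sumZ; apply: eq_bigr => J _; congr (_ *: _).
  by apply: eq_bigr => l _; rewrite !ffunE.
by rewrite (linear_sumZ f1L) (linear_sumZ f2L); apply: eq_bigr => J _; rewrite f12.
Qed.

(** The universal property of [H] for algebra morphisms. *)
Lemma end_lift (C : algType K) (g : {linear 'Hom(V, V) -> C}) :
  (forall n (f x : word n -> K), (2 <= n)%N -> R n x -> perp (R n) f ->
     rel_value a (fun=> g) f x = 0) ->
  exists theta : {lrmorphism H -> C}, forall psi, theta (i psi) = g psi.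
Proof.
move=> gR; case: pres => Hind _ /(_ C (fun=> g))[n _ f x|theta thetaE].
  exact: gR.
have thetaM : monoid_morphism theta.
  by apply: (@word_morphism _ _ _ _ i g theta Hind) => s; rewrite thetaE gprod_const.
exists (algebra_map (@linearP _ _ _ _ theta) thetaM) => psi /=.
by have := thetaE [:: psi]; rewrite gprod_const !big_seq1.
Qed.

(** The morphism [z_k^l |-> a^l (g a_k) * t]. The parameter [t] records the
    degree. *)
Lemma character (g : 'End(V)) (C : algType K) (t : C) :
  (forall n x, (2 <= n)%N -> R n x -> R n (act (fun=> g) x)) ->
  exists rho : {lrmorphism H -> C},
    forall psi, rho (i psi) = (\sum_m coord a m (g (psi (tnth a m)))) *: t.
Proof.
move=> gR; have trL : linear (fun psi : 'End(V) => (\sum_m coord a m (g (psi (tnth a m)))) *: t).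
  move=> c u v; rewrite scalerA -scalerDl mulr_sumr -big_split; congr (_ *: _).
  by apply: eq_bigr => m _; rewrite add_lfunE scale_lfunE !linearP.
have [|rho rhoE] := @end_lift C (linear_map trL); last by exists rho.
move=> n f x n2 Rx pf; rewrite /rel_value.
have trz k l : \sum_m coord a m (g (zgen a k l (tnth a m))) = coord a l (g (tnth a k)).
  by under eq_bigr => m _ do rewrite zgenE !linearZ; rewrite sum_delta.
have trzt k l : linear_map trL (zgen a k l) = coord a l (g (tnth a k)) *: t.
  by rewrite /= trz.
transitivity ((\sum_I f I * act (fun=> g) x I) *: t ^+ n); last first.
  by rewrite (pf _ (gR _ _ n2 Rx)) scale0r.
rewrite [RHS]scaler_suml; apply: eq_bigr => I _.
rewrite [in RHS]/act [in RHS]mulr_sumr [RHS]scaler_suml.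
apply: eq_bigr => J _; rewrite mulrA -[RHS]scalerA; congr (_ *: _).
under eq_bigr => l _ do rewrite [linear_map _ _]trzt.
by rewrite prodZ prodr_const card_ord.
Qed.

(** The relations form a coideal: the coproduct vanishes on them. *)
Lemma zword_coideal n (f x : word n -> K) : (2 <= n)%N -> R n x -> perp (R n) f ->
  \sum_I \sum_J (f I * x J) *: (\sum_M zword J M *t zword M I) = 0.
Proof.
move=> n2 Rx pf; case: pres => _ Hrel _.
have [c [cw ck]] := family_projection (fun J : word n => \prod_l j (tnth a (J l))).
(* The columns of c annihilate the relations, so they give relations with x. *)
have left0 L : \sum_M \sum_J (c M L * x J) *: zword J M = 0.
  by apply: Hrel => // y Ry; rewrite -[RHS](ck y Ry L); apply: eq_bigr => M _; rewrite mulrC.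
(* The rows of 1 - c are relations, so f annihilates them in H. *)
have right0 M : \sum_I f I *: zword M I = \sum_L c M L *: \sum_I f I *: zword L I.
  pose y L := (M == L)%:R - c M L.
  have Ry : R n y.
    rewrite /ker_of /y; under eq_bigr => L _ do rewrite scalerBl.
    by rewrite sumrB sum_deltaZ -cw subrr.
  have := Hrel n f y n2 Ry pf; rewrite /rel_value => e; apply/eqP.
  rewrite -subr_eq0 -[X in _ == X]e; apply/eqP.
  transitivity (\sum_L y L *: \sum_I f I *: zword L I).
    by rewrite /y; under [RHS]eq_bigr => L _ do rewrite scalerBl; rewrite sumrB sum_deltaZ.
  under eq_bigr => L _ do rewrite scaler_sumr.
  rewrite exchange_big; apply: eq_bigr => I _; apply: eq_bigr => L _ /=.
  by rewrite scalerA mulrC.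
transitivity (\sum_M (\sum_J x J *: zword J M) *t (\sum_I f I *: zword M I)).
  transitivity (\sum_I \sum_J \sum_M (f I * x J) *: (zword J M *t zword M I)).
    by apply: eq_bigr => I _; apply: eq_bigr => J _; rewrite scaler_sumr.
  under [RHS]eq_bigr => M _ do rewrite tpure_sumr.
  rewrite [RHS]exchange_big; apply: eq_bigr => I _ /=.
  rewrite exchange_big; apply: eq_bigr => M _ /=.
  by rewrite tpure_suml; apply: eq_bigr => J _; rewrite tpureZl tpureZr scalerA mulrC.
transitivity (\sum_L (\sum_M \sum_J (c M L * x J) *: zword J M) *t (\sum_I f I *: zword L I)).
  under eq_bigr => M _ do rewrite right0 tpure_sumr.
  rewrite exchange_big; apply: eq_bigr => L _ /=.
  rewrite tpure_suml; apply: eq_bigr => M _; rewrite tpureZr -tpureZl scaler_sumr.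
  by congr (_ *t _); apply: eq_bigr => J _; rewrite scalerA.
by apply: big1 => L _; rewrite left0 tpure0l.
Qed.

(** Composition with [G] and [G'] in the basis of the entries. *)
Lemma hom_conj_zgen (G G' : 'End(V)) k l :
  (G \o zgen a k l \o G')%VF = \sum_q coord a q (G (tnth a k)) *:
    \sum_r coord a l (G' (tnth a r)) *: zgen a q r.
Proof.
apply/lfunP => v; rewrite !comp_lfunE /zgen dual_tensE dual_basisE linearZ /=.
rewrite sum_lfunE [in LHS](coord_sum aP (G (tnth a k))) scaler_sumr.
apply: eq_bigr => q _; rewrite scale_lfunE sum_lfunE scalerA mulrC -scalerA.
congr (_ *: _); rewrite [in LHS](coord_sum aP v) !linear_sum scaler_suml.
apply: eq_bigr => r _; rewrite !linearZ scale_lfunE dual_tensE dual_basisE scalerA.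
by rewrite [in RHS]mulrC.
Qed.

(** Conjugating the letters by [G l] and [G' l] acts separately on the two
    kinds of coordinates. *)
Lemma conj_prod n (G G' : nat -> 'End(V)) (I J : word n) :
  \prod_(l < n) i (G l \o zgen a (I l) (J l) \o G' l)%VF =
  \sum_(P : word n) \sum_(Q : word n) (wmat G I P * wmat G' Q J) *: zword P Q.
Proof.
transitivity (\prod_(l < n) \sum_q coord a q (G l (tnth a (I l))) *:
    i (\sum_r coord a (J l) (G' l (tnth a r)) *: zgen a q r)).
  apply: eq_bigr => l _; rewrite hom_conj_zgen linear_sum.
  by apply: eq_bigr => q _; rewrite linearZ.
rewrite prod_sumZ; apply: eq_bigr => P _.
transitivity (wmat G I P *:
   \prod_(l < n) \sum_r coord a (J l) (G' l (tnth a r)) *: i (zgen a (P l) r)).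
  congr (_ *: _); apply: eq_bigr => l _; rewrite linear_sum.
  by apply: eq_bigr => r _; rewrite linearZ.
rewrite prod_sumZ scaler_sumr; apply: eq_bigr => Q _.
by rewrite scalerA.
Qed.

(** Conjugating the letters of a relation acts on its two families of
    coordinates, so the result is again a relation as soon as the actions
    preserve the kernels. *)
Lemma conj_value n (G G' : nat -> 'End(V)) (f x : word n -> K) :
  rel_value a (fun l psi => i (G l \o psi \o G' l)%VF) f x =
  rel_value a (fun=> i) (coact G' f) (act G x).
Proof.
rewrite /rel_value.
transitivity (\sum_I \sum_J \sum_(P : word n) \sum_(Q : word n) ((f I * x J) *
  (wmat G J P * wmat G' Q I)) *: zword P Q).
  apply: eq_bigr => I _; apply: eq_bigr => J _; rewrite conj_prod scaler_sumr.
  apply: eq_bigr => P _; rewrite scaler_sumr; apply: eq_bigr => Q _.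
  by rewrite scalerA.
transitivity (\sum_(Q : word n) \sum_(P : word n) \sum_I \sum_J ((f I * x J) *
  (wmat G J P * wmat G' Q I)) *: zword P Q); last first.
  apply: eq_bigr => Q _; apply: eq_bigr => P _.
  rewrite /coact /act mulr_suml scaler_suml; apply: eq_bigr => I _.
  rewrite mulr_sumr scaler_suml; apply: eq_bigr => J _; congr (_ *: _).
  by rewrite [RHS]mulrACA; congr (_ * _); apply: mulrC.
under eq_bigr => I _ do (under eq_bigr => J _ do rewrite exchange_big; rewrite exchange_big).
rewrite exchange_big; apply: eq_bigr => Q _ /=.
under eq_bigr => I _ do rewrite exchange_big.
by rewrite exchange_big.
Qed.

End MatrixCoalgebra.

(** * The coproduct and the counit *)

Section EndCoproduct.
Variables (K : fieldType) (V : vectType K).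
Local Notation d := (\dim {:V}).
Variable a : d.-tuple V.
Hypothesis aP : basis_of {:V} a.
Local Notation word := (word V).
Variables (B : algType K) (j : V -> B).
Local Notation R := (fun n => @ker_of K V a B j n).
Variables (H : algType K) (i : {linear 'Hom(V, V) -> H}).
Hypothesis pres : end_presentation a R i.
Local Notation zword := (zword a i).

Lemma counit : exists eps : {lrmorphism H -> K^o},
  forall psi, eps (i psi) = \sum_m coord a m (psi (tnth a m)).
Proof.
have [|eps epsE] := @character _ _ _ aP _ _ _ _ pres \1%VF K^o 1.
  by move=> n x _ Rx; rewrite (act_id aP).
exists eps => psi; rewrite epsE -[RHS]mulr1; congr (_ * _).
by apply: eq_bigr => m _; rewrite id_lfunE.
Qed.

Lemma one_tens_neq0 : 1 *t 1 != 0 :> tens H H.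
Proof.
(* The form eps (x) eps takes the value 1 at this tensor. *)
have [eps _] := counit; apply/eqP => /(congr1 (@tmul K K^o \o tmap eps eps)).
rewrite linear0 /= tmapE tmulE !rmorph1 mulr1 => /eqP.
by rewrite oner_eq0.
Qed.

(** The coproduct is multiplicative, as a morphism to the algebra [H (x) H]. *)
Lemma coproduct : exists Delta : {linear H -> tens H H},
  [/\ forall phi v, Delta (i (dual_tens phi v)) =
        \sum_k i (dual_tens (dual_basis a k) v) *t i (dual_tens phi (tnth a k)),
      Delta 1 = 1 *t 1,
      forall x y, Delta (x * y) = tens_mul H H (Delta x *t Delta y)
    & forall n (I J : word n), Delta (zword I J) = \sum_M zword I M *t zword M J].
Proof.
pose D (v : V) (phi : dual V) : tens H H :=
  \sum_k i (dual_tens (dual_basis a k) v) *t i (dual_tens phi (tnth a k)).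
have Dl phi : linear (D^~ phi).
  move=> c u v; rewrite /D scaler_sumr -big_split; apply: eq_bigr => k _ /=.
  by rewrite dual_tens_linear_r linearP tpure_linear_l.
have Dr v : linear (D v).
  move=> c phi psi; rewrite /D scaler_sumr -big_split; apply: eq_bigr => k _ /=.
  by rewrite dual_tens_linear_l linearP tpure_linear_r.
pose ax := tens_algebra_axioms one_tens_neq0.
pose delta : {linear 'Hom(V, V) -> alg_of ax} := linear_map (hom_lift_linear a Dl).
have deltaz n (I J : word n) : \prod_l delta (zgen a (I l) (J l)) =
    \sum_M zword I M *t zword M J :> alg_of ax.
  transitivity (\prod_l \sum_k
     (i (zgen a (I l) k) *t i (zgen a k (J l)) : alg_of ax)).
    by apply: eq_bigr => l _; apply: (hom_liftE aP Dl Dr).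
  rewrite prod_sum; apply: eq_bigr => M _; exact: tens_prod.
have [|theta thetaE] := end_lift pres (g := delta).
  move=> n f x n2 Rx pf; rewrite /rel_value.
  under eq_bigr => I _ do under eq_bigr => J _ do rewrite deltaz.
  exact: (zword_coideal pres n2 Rx pf).
exists (linear_map (@linearP _ _ _ _ theta)); split=> /=.
- by move=> phi v; rewrite thetaE; apply: (hom_liftE aP Dl Dr).
- exact: (rmorph1 theta).
- exact: (rmorphM theta).
- by move=> n I J; rewrite -deltaz rmorph_prod; apply: eq_bigr => l _; apply: thetaE.
Qed.

End EndCoproduct.

(** * The bialgebra axioms, the cocycle and the twisted product *)

Section ConvolutionSums.
Variable K : fieldType.

Lemma tmap_sum (V V' W W' : lmodType K) (f : {linear V -> W}) (g : {linear V' -> W'})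
    (I : finType) (F : I -> tens V V') :
  tmap f g (\sum_i F i) = \sum_i tmap f g (F i).
Proof. exact: linear_sum. Qed.

(** Coproducts in a tensor product of coalgebras, from given decompositions
    of the coproducts of the factors. *)
Lemma tens_coprodE (C D : lmodType K) (dC : {linear C -> tens C C})
    (dD : {linear D -> tens D D}) (I J : finType) (x : C) (y : D)
    (x1 x2 : I -> C) (y1 y2 : J -> D) :
  dC x = \sum_p x1 p *t x2 p -> dD y = \sum_q y1 q *t y2 q ->
  tens_coprod dC dD (x *t y) =
    \sum_(r : I * J) (x1 r.1 *t y1 r.2) *t (x2 r.1 *t y2 r.2).
Proof.
move=> xE yE; rewrite /tens_coprod /= tmapE xE yE tpure_suml linear_sum.
rewrite -(pair_bigA _ (fun p q => (x1 p *t y1 q) *t (x2 p *t y2 q))) /=.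
apply: eq_bigr => p _; rewrite tpure_sumr linear_sum.
by apply: eq_bigr => q _; rewrite /= tmiddleE.
Qed.

Lemma convE (C : lmodType K) (dC : {linear C -> tens C C}) (B : algType K)
    (f g : {linear C -> B}) (I : finType) (x : C) (x1 x2 : I -> C) :
  dC x = \sum_p x1 p *t x2 p -> conv dC f g x = \sum_p f (x1 p) * g (x2 p).
Proof.
move=> xE; rewrite /conv /= xE.
rewrite tmap_sum (linear_sum (@tmul K B)).
by apply: eq_bigr => p _; rewrite /= tmapE tmulE.
Qed.

(** The value on a polynomial of the linear form sending ['X^r] to [c r]. *)
Definition poly_form (c : nat -> K) (p : {poly K}) : K^o := \sum_(r < size p) p`_r * c r.

Lemma poly_form_linear c : linear (poly_form c).
Proof.
(* Any upper bound of the size may be used as range of the sum. *)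
have wide n (p : {poly K}) : (size p <= n)%N -> poly_form c p = \sum_(r < n) p`_r * c r.
  move=> pn; rewrite /poly_form (big_ord_widen _ (fun r => p`_r * c r) pn) big_mkcond.
  by apply: eq_bigr => r _; case: ltnP => // pr; rewrite nth_default // mul0r.
move=> k p q; set n := maxn (size (k *: p + q)) (maxn (size p) (size q)).
rewrite !(wide n) ?leq_max ?leqnn ?orbT // scaler_sumr -big_split.
by apply: eq_bigr => r _; rewrite coefD coefZ mulrDl -[k *: _]/(k * _) mulrA.
Qed.

Lemma poly_formXn c n : poly_form c 'X^n = c n.
Proof.
rewrite /poly_form size_polyXn (bigD1 ord_max) //= coefXn eqxx mul1r big1 ?addr0 // => r rn.
by rewrite coefXn; case: eqP => [e|]; rewrite ?mul0r //; case/eqP: rn; apply/val_inj.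
Qed.

End ConvolutionSums.

Section EndForms.
Variables (K : fieldType) (V : vectType K).
Local Notation d := (\dim {:V}).
Variable a : d.-tuple V.
Hypothesis aP : basis_of {:V} a.
Local Notation word := (word V).
Variables (B : algType K) (j : V -> B).
Local Notation R := (fun n => @ker_of K V a B j n).
Variables (H : algType K) (i : {linear 'Hom(V, V) -> H}).
Hypothesis pres : end_presentation a R i.
Local Notation zword := (zword a i).

Local Notation mw g := (wmat a (fun=> g)).

Lemma character_zword (C : algType K) (t : C) (rho : {lrmorphism H -> C}) (g : 'End(V)) :
  (forall psi, rho (i psi) = (\sum_m coord a m (g (psi (tnth a m)))) *: t) ->
  forall n (I J : word n), rho (zword I J) = mw g I J *: t ^+ n.
Proof.
move=> rhoE n I J; rewrite rmorph_prod.
transitivity (\prod_(l < n) (coord a (J l) (g (tnth a (I l))) *: t)).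
  apply: eq_bigr => l _; apply: etrans (rhoE _) _; congr (_ *: _).
  by under eq_bigr => m _ do rewrite (zgenE aP) !linearZ; rewrite sum_delta.
by rewrite prodZ prodr_const card_ord.
Qed.

Lemma end_character_zword (rho : {lrmorphism H -> K^o}) (g : 'End(V)) :
  (forall psi, rho (i psi) = \sum_m coord a m (g (psi (tnth a m)))) ->
  forall n (I J : word n), rho (zword I J) = mw g I J.
Proof.
move=> rhoE n I J; rewrite (character_zword (t := 1) (g := g)).
  by rewrite expr1n; apply: mulr1.
by move=> psi; rewrite rhoE; apply/esym/mulr1.
Qed.

Variables (Delta : {linear H -> tens H H}) (eps : {linear H -> K^o}).
Hypothesis Delta1 : Delta 1 = 1 *t 1.
Hypothesis DeltaM : forall x y, Delta (x * y) = tens_mul H H (Delta x *t Delta y).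
Hypothesis Delta_zword : forall n (I J : word n), Delta (zword I J) = \sum_M zword I M *t zword M J.
Hypothesis epsM : monoid_morphism eps.
Hypothesis epsE : forall psi, eps (i psi) = \sum_m coord a m (psi (tnth a m)).

Lemma eps_zword n (I J : word n) : eps (zword I J) = (I == J)%:R.
Proof.
pose e := algebra_map (@linearP _ _ _ _ eps) epsM.
rewrite -(wmat_id aP (F := fun=> \1%VF)) // -[LHS]/(e _); apply: end_character_zword => psi.
by rewrite /= epsE; apply: eq_bigr => m _; rewrite id_lfunE.
Qed.

Lemma end_is_bialgebra : is_bialgebra Delta eps.
Proof.
have idL : linear (idfun : H -> H) by [].
split=> //.
- apply: (zword_eq aP pres) => [c x y|c x y|n I J]; [by rewrite !linearP|by rewrite !linearP|].
  rewrite Delta_zword !tmap_sum (linear_sum (@tassoc K H H H)).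
  under eq_bigr => M _ do
    rewrite tmapE Delta_zword tpure_suml (linear_sum (@tassoc K H H H)).
  rewrite exchange_big; apply: eq_bigr => M _ /=.
  rewrite tmapE /= Delta_zword tpure_sumr.
  by apply: eq_bigr => N _; rewrite tassocE.
- apply: (zword_eq aP pres) => [c x y|//|n I J]; first by rewrite !linearP.
  rewrite Delta_zword tmap_sum (linear_sum (@tscale_l K H)).
  under eq_bigr => M _ do rewrite tmapE /= tscale_lE eps_zword.
  by rewrite sum_deltaZ.
- apply: (zword_eq aP pres) => [c x y|//|n I J]; first by rewrite !linearP.
  rewrite Delta_zword tmap_sum (linear_sum (@tscale_r K H)).
  under eq_bigr => M _ do rewrite tmapE /= tscale_rE eps_zword eq_sym.
  by rewrite sum_deltaZ.
- by case: epsM.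
- by case: epsM.
Qed.

Lemma coprod2_zword n m (I J : word n) (P Q : word m) :
  coprod2 Delta (zword I J *t zword P Q) = \sum_(r : word n * word m)
    (zword I r.1 *t zword P r.2) *t (zword r.1 J *t zword r.2 Q).
Proof. exact: (tens_coprodE (Delta_zword I J) (Delta_zword P Q)). Qed.

Lemma coprod3_zword n m p (I J : word n) (P Q : word m) (S T : word p) :
  coprod3 Delta ((zword I J *t zword P Q) *t zword S T) =
  \sum_(r : (word n * word m) * word p)
    ((zword I r.1.1 *t zword P r.1.2) *t zword S r.2) *t
    ((zword r.1.1 J *t zword r.1.2 Q) *t zword r.2 T).
Proof. exact: (tens_coprodE (coprod2_zword I J P Q) (Delta_zword S T)). Qed.

(** Linear maps on [H (x) H] are determined by products of entries. *)
Lemma zword2_eq (U : lmodType K) (f1 f2 : tens H H -> U) : linear f1 -> linear f2 ->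
  (forall n m (I J : word n) (P Q : word m),
    f1 (zword I J *t zword P Q) = f2 (zword I J *t zword P Q)) -> f1 =1 f2.
Proof.
move=> L1 L2 f12; apply: tens_eq => // x y.
move: x; apply: (zword_eq aP pres) => [c x x'|c x x'|n I J]; try by rewrite tpure_linear_l ?L1 ?L2.
move: y; apply: (zword_eq aP pres) => [c y y'|c y y'|m P Q]; try by rewrite tpure_linear_r ?L1 ?L2.
exact: f12.
Qed.

Variables (g h : nat -> 'End(V)) (rho rho' : nat -> {lrmorphism H -> K^o}).
Hypothesis g0 : g 0 = \1%VF.
Hypothesis gD : forall m n, (g n \o g m)%VF = g (m + n)%N.
Hypothesis ghK : forall n, (h n \o g n)%VF = \1%VF.
Hypothesis hgK : forall n, (g n \o h n)%VF = \1%VF.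
Hypothesis rhoE : forall n psi, rho n (i psi) = \sum_m coord a m (g n (psi (tnth a m))).
Hypothesis rho'E : forall n psi, rho' n (i psi) = \sum_m coord a m (h n (psi (tnth a m))).

Variable deg : {lrmorphism H -> {poly K}}.
Hypothesis degE : forall psi, deg (i psi) = (\sum_m coord a m (psi (tnth a m))) *: 'X.

Lemma deg_zword n (I J : word n) : deg (zword I J) = (I == J)%:R *: 'X^n.
Proof.
rewrite -(wmat_id aP (F := fun=> \1%VF)) //; apply: character_zword => psi.
by rewrite degE; congr (_ *: _); apply: eq_bigr => m _; rewrite id_lfunE.
Qed.

(** The form [chi (x (x) y) = eps x * lambda r y] for [x] of degree [r], since
    [deg x] is then [eps x * 'X^r]. *)
Lemma graded_form (lambda : nat -> {linear H -> K^o}) :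
  exists chi : {linear tens H H -> K^o},
    forall x y, chi (x *t y) = poly_form (fun r => lambda r y) (deg x).
Proof.
pose F x y : K^o := poly_form (fun r => lambda r y) (deg x).
have Fl y : linear (F^~ y).
  by move=> c x x'; rewrite /F linearP poly_form_linear.
have Fr x : linear (F x).
  move=> c y y'; rewrite /F /poly_form scaler_sumr -big_split.
  apply: eq_bigr => r _; rewrite linearP mulrDr.
  by congr (_ + _); apply: mulrCA.
exists (linear_map (tens_lift_linear Fl Fr)) => x y.
exact: (tens_liftE Fl Fr).
Qed.

Lemma graded_formE (chi : {linear tens H H -> K^o}) (lambda : nat -> {linear H -> K^o})
    (c : K) n x y :
  (forall x y, chi (x *t y) = poly_form (fun r => lambda r y) (deg x)) ->
  deg x = c *: 'X^n -> chi (x *t y) = c * lambda n y.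
Proof.
move=> -> ->; rewrite -[LHS]/(linear_map (@poly_form_linear K _) _) linearZ /=.
by rewrite poly_formXn.
Qed.

Variables (chi chi' : {linear tens H H -> K^o}).
Hypothesis chiE : forall x y, chi (x *t y) = poly_form (fun r => rho r y) (deg x).
Hypothesis chi'E : forall x y, chi' (x *t y) = poly_form (fun r => rho' r y) (deg x).

Lemma chi_zword n (I J : word n) y : chi (zword I J *t y) = (I == J)%:R * rho n y.
Proof. exact: (graded_formE (lambda := rho) y chiE (deg_zword I J)). Qed.

Lemma chi'_zword n (I J : word n) y : chi' (zword I J *t y) = (I == J)%:R * rho' n y.
Proof. exact: (graded_formE (lambda := rho') y chi'E (deg_zword I J)). Qed.

Lemma rho_zword r n (I J : word n) : rho r (zword I J) = mw (g r) I J.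
Proof. exact: end_character_zword. Qed.

Lemma rho'_zword r n (I J : word n) : rho' r (zword I J) = mw (h r) I J.
Proof. exact: end_character_zword. Qed.

Lemma chi_counital : counital_form eps chi.
Proof.
move=> x; split.
  have -> : chi (1 *t x) = 1 * rho 0 x.
    by apply: (graded_formE (lambda := rho) _ chiE); rewrite rmorph1 scale1r.
  rewrite mul1r; move: x; apply: (zword_eq aP pres) => [c x y|c x y|n I J].
  - exact: linearP.
  - exact: linearP.
  by rewrite [RHS]eps_zword rho_zword wmat_id.
move: x; apply: (zword_eq aP pres) => [c x y|c x y|n I J].
- by rewrite tpure_linear_l linearP.
- exact: linearP.
by rewrite [RHS]eps_zword chi_zword rmorph1 mulr1.
Qed.

Lemma sum_pair_delta n m (F : word n * word m -> K) (I : word n) :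
  \sum_r (I == r.1)%:R * F r = \sum_Q F (I, Q).
Proof.
transitivity (\sum_r (I == r.1)%:R * F (r.1, r.2)); first by apply: eq_bigr => -[].
rewrite -(pair_bigA _ (fun P Q => (I == P)%:R * F (P, Q))) exchange_big.
by apply: eq_bigr => Q _ /=; rewrite (sum_delta I (fun P => F (P, Q))).
Qed.

(** Convolution of two graded forms given by characters of mutually inverse
    linear maps. *)
Lemma form_inverse (f1 f2 : {linear tens H H -> K^o}) (k1 k2 : nat -> 'End(V))
    (mu1 mu2 : nat -> {lrmorphism H -> K^o}) :
  (forall n (I J : word n) y, f1 (zword I J *t y) = (I == J)%:R * mu1 n y) ->
  (forall n (I J : word n) y, f2 (zword I J *t y) = (I == J)%:R * mu2 n y) ->
  (forall r n (I J : word n), mu1 r (zword I J) = mw (k1 r) I J) ->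
  (forall r n (I J : word n), mu2 r (zword I J) = mw (k2 r) I J) ->
  (forall n, k2 n \o k1 n = \1)%VF ->
  conv (coprod2 Delta) f1 f2 =1 eps2 eps.
Proof.
move=> f1E f2E mu1E mu2E k12.
apply: zword2_eq => [c x y|c x y|n m I J P Q]; [exact: linearP|exact: linearP|].
rewrite (convE _ _ (coprod2_zword _ _ _ _)).
under eq_bigr => r _ do rewrite f1E f2E -mulrA.
rewrite sum_pair_delta /=.
under eq_bigr => M _ do rewrite mulrCA mu1E mu2E.
by rewrite -mulr_sumr (wmat_comp aP) (wmat_id aP) // /eps2 /= tmapE tmulE !eps_zword.
Qed.

(** [chi'] is the convolution inverse of [chi]. *)
Lemma chi_inverse : conv_inverse Delta eps chi chi'.
Proof.
split.
  exact: (form_inverse chi_zword chi'_zword rho_zword rho'_zword).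
exact: (form_inverse chi'_zword chi_zword rho'_zword rho_zword).
Qed.

Lemma zword3_eq (U : lmodType K) (f1 f2 : tens (tens H H) H -> U) : linear f1 -> linear f2 ->
  (forall n m p (I J : word n) (P Q : word m) (S T : word p),
    f1 ((zword I J *t zword P Q) *t zword S T) = f2 ((zword I J *t zword P Q) *t zword S T)) -> f1 =1 f2.
Proof.
move=> L1 L2 f12; apply: tens_eq => // x y.
move: x; apply: zword2_eq => [c x x'|c x x'|n m I J P Q]; try by rewrite tpure_linear_l ?L1 ?L2.
move: y; apply: (zword_eq aP pres) => [c y y'|c y y'|p S T]; try by rewrite tpure_linear_r ?L1 ?L2.
exact: f12.
Qed.

Lemma chi12E x y z : chi12 eps chi ((x *t y) *t z) = chi (x *t y) * eps z.
Proof. by rewrite /chi12 /= tmapE tmulE. Qed.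

Lemma chi23E x y z : chi23 eps chi ((x *t y) *t z) = eps x * chi (y *t z).
Proof.
transitivity (tmul (tmap eps chi (tassoc ((x *t y) *t z)))); first by [].
by rewrite tassocE tmapE tmulE.
Qed.

Lemma chi_mu_idE x y z : chi_mu_id chi ((x *t y) *t z) = chi ((x * y) *t z).
Proof. by rewrite /chi_mu_id /= tmapE /= tmulE. Qed.

Lemma chi_id_muE x y z : chi_id_mu chi ((x *t y) *t z) = chi (x *t (y * z)).
Proof.
transitivity (chi (tmap idfun (@tmul K H) (tassoc ((x *t y) *t z)))); first by [].
by rewrite tassocE tmapE /= tmulE.
Qed.

Lemma chi_cocycle : cocycle Delta eps chi.
Proof.
apply: zword3_eq => [c x y|c x y|n m p I J P Q S T]; [exact: linearP|exact: linearP|].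
have conv3 f1 f2 := convE f1 f2 (coprod3_zword I J P Q S T).
rewrite [LHS]conv3 [RHS]conv3.
have chiM (r : word n * word m) y :
    chi ((zword r.1 J * zword r.2 Q) *t y) = (r.1 == J)%:R * (r.2 == Q)%:R * rho (n + m)%N y.
  apply: (graded_formE (lambda := rho) _ chiE).
  have -> u v : deg (u * v) = deg u * deg v by apply: rmorphM.
  by rewrite !deg_zword -scalerAl -scalerAr scalerA exprD.
transitivity ((I == J)%:R * (mw (g n) P Q * mw (g (n + m)) S T) : K).
  transitivity (\sum_(r : word n * word m) \sum_M
     ((I == r.1)%:R * (mw (g n) P r.2 * (S == M)%:R)) *
       ((r.1 == J)%:R * (r.2 == Q)%:R * mw (g (n + m)) M T) : K).
    rewrite pair_big /=; apply: eq_bigr => r _.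
    apply: etrans (congr2 *%R (chi12E _ _ _) (chi_mu_idE _ _ _)) _.
    rewrite chi_zword rho_zword eps_zword chiM rho_zword.
    by congr (_ * _); apply/esym/mulrA.
  transitivity (\sum_(r : word n * word m) (I == r.1)%:R *
      ((r.1 == J)%:R * ((r.2 == Q)%:R * (mw (g n) P r.2 * mw (g (n + m)) S T))) : K).
    apply: eq_bigr => r _; rewrite -(sum_delta S (fun M => mw (g (n + m)) M T)).
    rewrite !mulr_sumr; apply: eq_bigr => M _.
    have e (u v w x y z : K) : u * (v * w) * (x * y * z) = u * (x * (y * (v * (w * z)))).
      by ring.
    exact: e.
  rewrite sum_pair_delta /= -mulr_sumr; congr (_ * _).
  by under eq_bigr => M _ do rewrite eq_sym; rewrite sum_delta.
transitivity (\sum_(r : word n * word m) \sum_M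
     ((I == r.1)%:R * ((P == r.2)%:R * mw (g m) S M)) *
       ((r.1 == J)%:R * (mw (g n) r.2 Q * mw (g n) M T)) : K); last first.
  rewrite pair_big /=; apply: eq_bigr => r _.
  have rhoM u v : rho n (u * v) = rho n u * rho n v by apply: rmorphM.
  symmetry; apply: etrans (congr2 *%R (chi23E _ _ _) (chi_id_muE _ _ _)) _.
  rewrite chi_zword chi_zword eps_zword rhoM !rho_zword.
  by [].
symmetry; transitivity (\sum_(r : word n * word m) (I == r.1)%:R *
      ((r.1 == J)%:R * ((P == r.2)%:R * (mw (g n) r.2 Q * mw (g (n + m)) S T))) : K).
  apply: eq_bigr => r _; rewrite addnC -gD -(wmat_comp aP (fun=> g m) (fun=> g n)).
  rewrite !mulr_sumr; apply: eq_bigr => M _.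
  have e (u v w x y z : K) : u * (v * (w * (x * (y * z)))) = u * (w * y) * (v * (x * z)).
    by ring.
  exact/esym/e.
rewrite sum_pair_delta /= -mulr_sumr; congr (_ * _).
by rewrite sum_delta.
Qed.

Lemma sum_pair_deltaZ (U : lmodType K) n m (F : word n * word m -> U) (I : word n) :
  \sum_r (I == r.1)%:R *: F r = \sum_Q F (I, Q).
Proof.
transitivity (\sum_r (I == r.1)%:R *: F (r.1, r.2)); first by apply: eq_bigr => -[].
rewrite -(pair_bigA _ (fun P Q => (I == P)%:R *: F (P, Q))) exchange_big.
by apply: eq_bigr => Q _ /=; rewrite (sum_deltaZ I (fun P => F (P, Q))).
Qed.

Lemma unit_mapMl (c : K^o) (x : H) : unit_map H c * x = (c : K) *: x.
Proof. by rewrite /unit_map -scalerAl mul1r. Qed.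

Lemma unit_mapMr (c : K^o) (x : H) : x * unit_map H c = (c : K) *: x.
Proof. by rewrite /unit_map -scalerAr mulr1. Qed.

(** The twisted product conjugates the letters of the second factor by the
    power of the automorphism given by the degree of the first factor. *)
Lemma twisted_mul_zword n m (I J : word n) (P Q : word m) :
  twisted_mul Delta chi chi' (zword I J *t zword P Q) =
  zword I J * \prod_(l < m) i (g n \o zgen a (P l) (Q l) \o h n)%VF.
Proof.
have inner (I' J' : word n) (P' Q' : word m) :
    conv (coprod2 Delta) (@unit_map K H \o chi) (@tmul K H) (zword I' J' *t zword P' Q') =
    \sum_S mw (g n) P' S *: (zword I' J' * zword S Q').
  rewrite (convE _ _ (coprod2_zword _ _ _ _)).
  transitivity (\sum_(r : word n * word m) (I' == r.1)%:R *:
      (mw (g n) P' r.2 *: (zword r.1 J' * zword r.2 Q'))).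
    apply: eq_bigr => r _; rewrite /= tmulE unit_mapMl chi_zword rho_zword.
    by rewrite -scalerA.
  by rewrite sum_pair_deltaZ.
rewrite (convE _ _ (coprod2_zword _ _ _ _)).
transitivity (\sum_(r : word n * word m) (J == r.1)%:R *:
    (mw (h n) r.2 Q *: \sum_S mw (g n) P S *: (zword I r.1 * zword S r.2))).
  apply: eq_bigr => r _; rewrite inner /= unit_mapMr chi'_zword rho'_zword.
  by rewrite -scalerA eq_sym.
rewrite sum_pair_deltaZ /= (conj_prod aP _ (fun=> g n) (fun=> h n)).
under eq_bigr => T _ do rewrite scaler_sumr.
rewrite exchange_big mulr_sumr; apply: eq_bigr => S _ /=.
rewrite mulr_sumr; apply: eq_bigr => T _.
by rewrite -scalerAr scalerA mulrC.
Qed.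

End EndForms.

(** * Twist maps, and transport of structure *)

Section TwistMap.
Variables (K : fieldType) (V : vectType K).
Local Notation d := (\dim {:V}).
Variable a : d.-tuple V.
Hypothesis aP : basis_of {:V} a.
Local Notation word := (word V).
Variables (B : algType K) (j : V -> B) (B' : algType K) (j' : V -> B').
Local Notation R := (fun n => @ker_of K V a B j n).
Local Notation R' := (fun n => @ker_of K V a B' j' n).
Variables (H : algType K) (i : {linear 'Hom(V, V) -> H}).
Variables (H' : algType K) (i' : {linear 'Hom(V, V) -> H'}).
Hypothesis pres : end_presentation a R i.
Hypothesis pres' : end_presentation a R' i'.

Lemma conj_linear (G G' : 'End(V)) : linear (fun psi => i' (G \o psi \o G')%VF).
Proof.
move=> c u v; rewrite -linearP; congr (i' _); apply/lfunP => w.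
by rewrite add_lfunE scale_lfunE !comp_lfunE add_lfunE scale_lfunE linearP.
Qed.

(** The map multiplying the letters [psi_l] after replacing them with
    [G l \o psi_l \o G' l]. The [x]-coordinates of relations are moved by [G],
    the [f]-coordinates by the transpose of [G'], whence the second hypothesis. *)
Lemma twist_map (G G' : nat -> 'End(V)) :
  (forall n p (x : word n -> K), (2 <= n)%N -> R n x ->
     R' n (act a (fun l => G (p + l)%N) x)) ->
  (forall n p (y : word n -> K), (2 <= n)%N -> R' n y ->
     R n (act a (fun l => G' (p + l)%N) y)) ->
  exists f : {linear H -> H'}, forall s,
    f (\prod_(v <- s) i v) = gprod (fun l => linear_map (conj_linear (G l) (G' l))) 0 s.
Proof.
move=> RR' R'R; case: pres => _ _; apply=> n p f x n2 Rx pf.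
have := conj_value aP i' (fun l => G (p + l)%N) (fun l => G' (p + l)%N) f x.
rewrite /rel_value /= => ->; case: pres' => _ rel' _; apply: rel' => //.
  exact: RR'.
by move=> y Ry; rewrite coact_act pf //; apply: R'R.
Qed.

End TwistMap.

Section TwistMapTheory.
Variables (K : fieldType) (V : vectType K).
Local Notation d := (\dim {:V}).
Variable a : d.-tuple V.
Hypothesis aP : basis_of {:V} a.
Local Notation word := (word V).
Variables (H : algType K) (i : {linear 'Hom(V, V) -> H}).
Variables (H' : algType K) (i' : {linear 'Hom(V, V) -> H'}).
Variables (G G' : nat -> 'End(V)).
Hypothesis G'GK : forall l, (G' l \o G l)%VF = \1%VF.
Hypothesis GG'K : forall l, (G l \o G' l)%VF = \1%VF.
Variable f : {linear H -> H'}.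
Hypothesis fE : forall s,
  f (\prod_(v <- s) i v) = gprod (fun l => linear_map (conj_linear i' (G l) (G' l))) 0 s.

Lemma twist_map_zword n (I J : word n) :
  f (zword a i I J) = \prod_(l < n) i' (G l \o zgen a (I l) (J l) \o G' l)%VF.
Proof.
rewrite /zword -(big_letters (fun l => zgen a (I l) (J l))) fE gprod_letters.
by apply: eq_bigr => l _; rewrite add0n.
Qed.

Lemma twist_map1 : f 1 = 1.
Proof. by have := fE [::]; rewrite big_nil gprod_nil. Qed.

Lemma twist_map_gen psi : (forall v, G 0 v = v) -> (forall v, G' 0 v = v) -> f (i psi) = i' psi.
Proof.
move=> G0 G'0; have := fE [:: psi]; rewrite gprod_cons gprod_nil mulr1 big_seq1 => -> /=.
by congr (i' _); apply/lfunP => v; rewrite !comp_lfunE /= G0 G'0.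
Qed.

Local Notation wmat := (wmat a).

(** Contraction of two families whose coefficient matrices are inverse. *)
Lemma sum_tens_dual (W W' : lmodType K) (X : finType) (u w : X -> X -> K)
    (A : X -> W) (C : X -> W') :
  (forall x y, \sum_z u x z * w z y = (x == y)%:R) ->
  \sum_z (\sum_x u x z *: A x) *t (\sum_y w z y *: C y) = \sum_x A x *t C x.
Proof.
move=> uw.
transitivity (\sum_z \sum_x \sum_y (u x z * w z y) *: (A x *t C y)).
  apply: eq_bigr => z _; rewrite tpure_suml; apply: eq_bigr => x _.
  rewrite tpure_sumr; apply: eq_bigr => y _.
  by rewrite tpureZl tpureZr scalerA.
rewrite exchange_big; apply: eq_bigr => x _ /=; rewrite exchange_big /=.
under eq_bigr => y _ do rewrite -scaler_suml uw.
by rewrite sum_deltaZ.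
Qed.

Lemma twist_map_sum n (I J : word n) :
  f (zword a i I J) = \sum_P \sum_Q (wmat G I P * wmat G' Q J) *: zword a i' P Q.
Proof. by rewrite twist_map_zword (conj_prod aP). Qed.

(** Twist maps respect coproducts: the matrices in the two middle positions
    cancel. *)
Lemma twist_map_comult (Delta : {linear H -> tens H H}) (Delta' : {linear H' -> tens H' H'}) :
  (forall n (I J : word n), Delta (zword a i I J) = \sum_M zword a i I M *t zword a i M J) ->
  (forall n (I J : word n), Delta' (zword a i' I J) = \sum_M zword a i' I M *t zword a i' M J) ->
  forall n (I J : word n), Delta' (f (zword a i I J)) = tmap f f (Delta (zword a i I J)).
Proof.
move=> DE D'E n I J.
pose A M := \sum_P wmat G I P *: zword a i' P M.
pose C M := \sum_Q wmat G' Q J *: zword a i' M Q.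
transitivity (\sum_M A M *t C M).
  rewrite twist_map_sum linear_sum.
  transitivity (\sum_P \sum_Q \sum_M (wmat G I P * wmat G' Q J) *: (zword a i' P M *t zword a i' M Q)).
    apply: eq_bigr => P _; rewrite linear_sum; apply: eq_bigr => Q _.
    by rewrite linearZ_LR D'E scaler_sumr.
  rewrite /A /C; under [RHS]eq_bigr => M _ do rewrite tpure_suml.
  rewrite [RHS]exchange_big; apply: eq_bigr => P _ /=.
  rewrite exchange_big; apply: eq_bigr => M _ /=.
  rewrite tpure_sumr; apply: eq_bigr => Q _.
  by rewrite tpureZl tpureZr scalerA.
rewrite DE tmap_sum.
have dualE (x y : word n) : \sum_z wmat G' x z * wmat G z y = (x == y)%:R.
  by rewrite (wmat_comp aP) (wmat_id aP).
rewrite -(sum_tens_dual A C dualE); apply: eq_bigr => N _.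
rewrite tmapE !twist_map_sum; congr (_ *t _).
  rewrite /A exchange_big; apply: eq_bigr => M _; rewrite scaler_sumr.
  by apply: eq_bigr => P _; rewrite scalerA mulrC.
apply: eq_bigr => M _; rewrite /C scaler_sumr.
by apply: eq_bigr => Q _; rewrite scalerA.
Qed.

Lemma twist_map_counit (eps' : {linear H' -> K^o}) :
  (forall n (I J : word n), eps' (zword a i' I J) = (I == J)%:R) ->
  forall n (I J : word n), eps' (f (zword a i I J)) = (I == J)%:R.
Proof.
move=> e'E n I J; rewrite twist_map_sum -(wmat_id aP (F := fun l => (G' l \o G l)%VF)) // -(wmat_comp aP) linear_sum.
apply: eq_bigr => P _; rewrite linear_sum.
rewrite -[RHS](sum_delta P (fun Q => wmat G I P * wmat G' Q J)).
by apply: eq_bigr => Q _; rewrite linearZ e'E; apply: mulrC.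
Qed.

End TwistMapTheory.

(** The twist maps for [G], [G'] and for [G'], [G] are inverse of each other. *)
Lemma twist_mapK (K : fieldType) (V : vectType K) (H H' : algType K)
    (i : {linear 'Hom(V, V) -> H}) (i' : {linear 'Hom(V, V) -> H'})
    (G G' : nat -> 'End(V)) (f : {linear H -> H'}) (f' : {linear H' -> H}) :
  (forall l v, G' l (G l v) = v) ->
  (forall s, f (\prod_(v <- s) i v) =
     gprod (fun l => linear_map (conj_linear i' (G l) (G' l))) 0 s) ->
  (forall s, f' (\prod_(v <- s) i' v) =
     gprod (fun l => linear_map (conj_linear i (G' l) (G l))) 0 s) ->
  (forall (U : lmodType K) (f1 f2 : H -> U), linear f1 -> linear f2 ->
     (forall s, f1 (\prod_(v <- s) i v) = f2 (\prod_(v <- s) i v)) -> f1 =1 f2) ->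
  cancel f f'.
Proof.
move=> G'GK fE f'E Hind; apply: Hind => [c x y|//|s]; first by rewrite !linearP.
rewrite fE (letters_nth 0 s) gprod_letters.
rewrite -(big_letters (fun l : 'I_(size s) => (G (0 + l)%N \o s`_l \o G' (0 + l)%N)%VF)).
rewrite f'E gprod_letters [RHS]big_letters; apply: eq_bigr => l _ /=.
by congr (i _); apply/lfunP => v; rewrite !comp_lfunE !add0n !G'GK.
Qed.

Lemma tmap_ext (K : fieldType) (V V' W W' : lmodType K) (f g : {linear V -> W})
    (f' g' : {linear V' -> W'}) : f =1 g -> f' =1 g' -> tmap f f' =1 tmap g g'.
Proof.
move=> fg fg'; apply: tens_eq => [c x y|c x y|x y]; [exact: linearP|exact: linearP|].
by rewrite !tmapE fg fg'.
Qed.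

Section Transport.
Variables (K : fieldType) (E : lmodType K) (H H' : algType K).
Variables (i : E -> H) (i' : E -> H').
Variables (Delta : {linear H -> tens H H}) (eps : {linear H -> K^o}).
Variables (Delta' : {linear H' -> tens H' H'}) (eps' : {linear H' -> K^o}).
Variables (mu : {linear tens H H -> H}) (f : {linear H -> H'}) (f' : {linear H' -> H}).
Hypotheses (fK : cancel f f') (f'K : cancel f' f).
Hypothesis fM : forall x y, f (mu (x *t y)) = f x * f y.
Hypothesis f1 : f 1 = 1.
Hypothesis fi : forall v, f (i v) = i' v.
Hypothesis fDelta : forall x, Delta' (f x) = tmap f f (Delta x).
Hypothesis feps : forall x, eps' (f x) = eps x.

(** [f] is a linear bijection which turns [mu] into the product of [H']. *)
Lemma transport_axioms : algebra_axioms mu 1.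
Proof.
split=> [x y z|x|x|]; last exact: oner_neq0.
- by apply: (can_inj fK); rewrite !fM mulrA.
- by apply: (can_inj fK); rewrite fM f1 mul1r.
- by apply: (can_inj fK); rewrite fM f1 mulr1.
Qed.

Let Ht := alg_of transport_axioms.

Lemma transport_morphism : monoid_morphism (f : Ht -> H').
Proof. by split=> [|x y]; [exact: f1 | exact: fM]. Qed.

Lemma transport_inverse : monoid_morphism (f' : H' -> Ht).
Proof.
split=> [|x y]; apply: (can_inj fK); rewrite f'K; first exact: (esym f1).
by rewrite [RHS]fM !f'K.
Qed.

Lemma transport_generates : generates i' -> @generates K E Ht i.
Proof.
move=> gen' S [S1 SL SM] Si x; rewrite -[x]fK.
(* The preimage of S under the isomorphism f' is a subalgebra of H'. *)
have S'c : GRing.subalg_closed [pred y | (f' y : Ht) \in S].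
  split=> [|c u v Su Sv|u v Su Sv]; rewrite !inE.
  - by have := transport_inverse.1 => ->.
  - by rewrite linearP; apply: SL.
  - by have := transport_inverse.2 u v => ->; apply: SM.
have := gen' _ S'c; apply=> v.
by rewrite inE -fi fK.
Qed.

Lemma tmapK : cancel (tmap f f) (tmap f' f').
Proof.
apply: tens_eq => [c x y|//|x y]; first by rewrite !linearP.
by rewrite !tmapE !fK.
Qed.

(** [f (x) f] turns the componentwise product [mu] of tensors into the product
    of the algebra [H' (x) H']. *)
Lemma tmap_tens_mu : {morph tmap f f : s t /
  tmap mu mu (tmiddle (s *t t)) >-> tens_mul H' H' (s *t t)}.
Proof.
move=> s t; move: s; apply: tens_eq => [c x y|c x y|x y].
- by rewrite tpure_linear_l !linearP.
- by rewrite linearP tpure_linear_l linearP.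
move: t; apply: tens_eq => [c z w|c z w|z w].
- by rewrite tpure_linear_r !linearP.
- by rewrite linearP tpure_linear_r linearP.
by rewrite tmiddleE !tmapE tens_mulE !fM.
Qed.

Lemma transport_comultM (bi' : is_bialgebra Delta' eps') x y :
  Delta (mu (x *t y)) = tmap mu mu (tmiddle (Delta x *t Delta y)).
Proof.
apply: (can_inj tmapK); rewrite tmap_tens_mu -!fDelta fM.
exact: coprodM bi' _ _.
Qed.

(** The product of [alg_of] is [mu], as a linear map on the tensor square. *)
Lemma tmul_alg_of : @tmul K Ht =1 mu.
Proof.
apply: (@tens_eq K Ht Ht Ht (@tmul K Ht) mu (@tmul_is_linear K Ht) (@linearP _ _ _ _ mu)).
exact: (@tmulE K Ht).
Qed.

Lemma transport_bialgebra : is_bialgebra Delta eps -> is_bialgebra Delta' eps' ->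
  @is_bialgebra K Ht Delta eps.
Proof.
move=> bi bi'; split.
- exact: coprod_assoc bi.
- exact: counit_l bi.
- exact: counit_r bi.
- exact: coprod1 bi.
- move=> x y; apply: (etrans (transport_comultM bi' x y)); symmetry.
  exact: (tmap_ext tmul_alg_of tmul_alg_of).
- exact: counit1 bi.
- move=> x y; rewrite -(feps x) -(feps y); apply: etrans (counitM bi' _ _).
  by rewrite -fM feps.
Qed.

End Transport.

(** * The relations of the twisted quantum space *)

Section Powers.
Variables (K : fieldType) (V : vectType K).

(** The powers of an endomorphism. *)
Definition lpow (s : 'End(V)) n : 'End(V) := iter n (comp_lfun s) \1%VF.

Lemma lpowE s n v : lpow s n v = iter n s v.
Proof.
elim: n => [|n IHn]; first by rewrite /lpow /= id_lfunE.
by rewrite /lpow /= comp_lfunE -/(lpow s n) IHn.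
Qed.

Lemma lpowD s m n : (lpow s n \o lpow s m)%VF = lpow s (m + n)%N.
Proof. by apply/lfunP => v; rewrite comp_lfunE !lpowE addnC iterD. Qed.

Lemma iterK (T : Type) (s s' : T -> T) n v : cancel s s' -> iter n s' (iter n s v) = v.
Proof. by move=> sK; elim: n v => // n IHn v; rewrite iterSr iterS sK IHn. Qed.

Lemma lpowK (s s' : 'End(V)) n : cancel s s' -> (lpow s' n \o lpow s n)%VF = \1%VF.
Proof. by move=> sK; apply/lfunP => v; rewrite comp_lfunE !lpowE iterK // id_lfunE. Qed.

End Powers.

Section TwistedRelations.
Variables (K : fieldType) (A : qspace K) (sigma : 'End(qs_gen A)).
Local Notation V := (qs_gen A).
Local Notation d := (\dim {:V}).
Variable a : d.-tuple V.
Hypothesis aP : basis_of {:V} a.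
Local Notation word := (word V).
Local Notation R := (fun n => @ker_of K V a _ (qs_incl A) n).
Let Au := upsilon sigma.
Local Notation Ru := (fun n => @ker_of K V a _ (qs_incl Au) n).
Local Notation sigma' := (sigma^-1)%VF.
Hypothesis sigmaK : cancel sigma sigma'.
Hypothesis sigma'K : cancel sigma' sigma.
Variables (f g : {lrmorphism qs_alg A -> qs_alg A}).
Hypothesis gK : cancel f g.
Hypothesis fE : forall v, f (qs_incl A v) = qs_incl A (sigma v).

(** Powers of a morphism preserve the kernel of the canonical epimorphism. *)
Lemma ker_morphism (h : {lrmorphism qs_alg A -> qs_alg A}) (s : V -> V) n p (x : word n -> K) :
  (forall v, h (qs_incl A v) = qs_incl A (s v)) -> R n x ->
  \sum_J x J *: \prod_l qs_incl A (iter p s (tnth a (J l))) = 0.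
Proof.
move=> hE Rx; elim: p => [|p IHp]; first exact: Rx.
have := congr1 h IHp; rewrite linear0 linear_sum => e; rewrite -[RHS]e.
apply: eq_bigr => J _; rewrite linearZ_LR rmorph_prod; congr (_ *: _).
by apply: eq_bigr => l _; apply/esym/hE.
Qed.

(** The inverse of the automorphism extends the inverse of [sigma]. *)
Lemma qs_incl_inverse v : g (qs_incl A v) = qs_incl A (sigma' v).
Proof. by rewrite -{1}[v]sigma'K -fE gK. Qed.

Lemma ker_sigma n p (x : word n -> K) : R n x -> R n (act a (fun=> lpow sigma p) x).
Proof.
move=> Rx; rewrite /ker_of (act_value aP (fun=> qs_incl A) (fun=> lpow sigma p)).
rewrite -[RHS](ker_morphism p fE Rx); apply: eq_bigr => J _; congr (_ *: _).
by apply: eq_bigr => l _; rewrite lpowE.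
Qed.

Lemma ker_sigma' n p (x : word n -> K) : R n x -> R n (act a (fun=> lpow sigma' p) x).
Proof.
move=> Rx; rewrite /ker_of (act_value aP (fun=> qs_incl A) (fun=> lpow sigma' p)).
rewrite -[RHS](ker_morphism p qs_incl_inverse Rx); apply: eq_bigr => J _; congr (_ *: _).
by apply: eq_bigr => l _; rewrite lpowE.
Qed.

(** [id (x) sigma (x) sigma^2 (x) ...] applied to the letters of a tensor. *)
Lemma twist_coords n (x : word n -> K) :
  twist sigma (\sum_J x J *: tword (letters (tnth a \o J))) =
  \sum_J x J *: tword (letters (fun l : 'I_n => iter l sigma (tnth a (J l)))).
Proof.
rewrite [LHS](linear_sumZ (@tlift_is_linear K V _ _)); apply: eq_bigr => J _; congr (_ *: _).
pose G l : {linear V -> talg V} := linear_map (fun c u v =>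
  etrans (congr1 (@tinj K V) (linearP (lpow sigma l) c u v)) (tinj_is_linear c _ _)).
have sz : size (letters (tnth a \o J)) = n by rewrite size_letters.
rewrite (@tlift_eq _ _ n _ _ (gprod G 0)); first last.
- move=> s _; rewrite /gprod /tword /mkseq big_map /index_iota subn0.
  by apply: eq_bigr => l _; rewrite add0n /= lpowE.
- exact: homogeneous_letters.
rewrite tlift_gprod gprod_letters /tword big_letters.
by apply: eq_bigr => l _; rewrite add0n /= lpowE.
Qed.

(** The relations of [A] are carried to relations of [A^Upsilon]; the shift by
    [p] costs nothing since [sigma^p] preserves the relations of [A]. *)
Lemma ker_to_twist n p (x : word n -> K) : (2 <= n)%N -> R n x ->
  Ru n (act a (fun l => lpow sigma (p + l)%N) x).
Proof.
move=> n2 Rx; (* First apply sigma^p in every position, and then twist. *)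
have := ker_sigma p Rx; set y := act _ _ _ => Ry.
have := TwistRel sigma n2 (coords_qs_rel Ry); rewrite twist_coords.
move=> /(@ideal_gen_in _ _ (@twist_rel K A sigma)); set t := \sum_J _ => ht.
have t0 : aproj (ideal_gen_proper (@twist_rel_low K A sigma)) t = 0.
  rewrite -(linear0 (aproj (ideal_gen_proper (@twist_rel_low K A sigma)))).
  by apply/qprojP; rewrite subr0.
pose j l : {linear V -> qs_alg Au} := linear_map (fun c u v =>
  etrans (congr1 (qs_incl Au) (linearP (lpow sigma l) c u v)) (linearP _ c _ _)).
rewrite /ker_of (act_value aP (fun=> qs_incl Au) (fun l => lpow sigma (p + l)%N)).
transitivity (\sum_J y J *: \prod_(l < n) j l (tnth a (J l))).
  apply: etrans (esym (act_value aP j (fun=> lpow sigma p) x)); apply: eq_bigr => J _; congr (_ *: _).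
  by apply: eq_bigr => l _; rewrite /j -lpowD comp_lfunE.
rewrite -[RHS]t0 /t.
rewrite (linear_sumZ (@aproj_is_linear _ _ _ (ideal_gen_proper (@twist_rel_low K A sigma)))).
apply: eq_bigr => J _; congr (_ *: _).
rewrite /tword big_letters; apply: etrans (esym (rmorph_prod _ _ _ _)).
by apply: eq_bigr => l _; rewrite /= lpowE.
Qed.

(** The converse: the map [v_0 * v_1 * ... |-> sigma'^p v_0 * sigma'^(p + 1) v_1 * ...]
    is well defined from [A^Upsilon] to [A], because it undoes the twist on the
    defining relations. *)
Lemma twist_to_ker n p (y : word n -> K) : Ru n y ->
  R n (act a (fun l => lpow sigma' (p + l)%N) y).
Proof.
move=> Ry; rewrite /ker_of (act_value aP (fun=> qs_incl A) (fun l => lpow sigma' (p + l)%N)).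
pose G l : {linear V -> qs_alg A} := linear_map (fun c u v =>
  etrans (congr1 (qs_incl A) (linearP (lpow sigma' (p + l)) c u v)) (linearP _ c _ _)).
(* On a twisted relation of degree m the powers of sigma' and of sigma in
   position l cancel, leaving the power p + q of sigma' in every position. *)
have [|theta thetaE] := @twisted_lift K V _ (@twist_rel_low K A sigma) _ G.
  move=> _ [m x m2 /(qs_rel_coords aP)[c -> Rc]]; exists m.
    by rewrite twist_coords; apply: homogeneous_lin => J; apply: homogeneous_letters.
  move=> q; rewrite twist_coords (linear_sumZ (@tlift_is_linear K V _ _)).
  rewrite -[RHS](ker_morphism (p + q) qs_incl_inverse Rc).
  apply: eq_bigr => J _; congr (_ *: _); rewrite tlift_gprod gprod_letters.
  by apply: eq_bigr => l _; rewrite /= lpowE addnA iterD iterK.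
have := congr1 theta Ry; rewrite linear0 => e; rewrite -[RHS]e.
rewrite (linear_sumZ (@linearP _ _ _ _ theta)); apply: eq_bigr => J _; congr (_ *: _).
rewrite -(big_letters (fun l : 'I_n => tnth a (J l))).
apply: esym; apply: etrans (thetaE _) _; rewrite gprod_letters.
by apply: eq_bigr => l _; rewrite add0n.
Qed.

End TwistedRelations.

(** * The twisting isomorphism *)

Section Twisting.
Variables (K : fieldType) (V : vectType K).
Local Notation d := (\dim {:V}).
Variable a : d.-tuple V.
Hypothesis aP : basis_of {:V} a.
Local Notation word := (word V).
Variables (B : algType K) (j : V -> B) (B' : algType K) (j' : V -> B').
Local Notation R := (fun n => @ker_of K V a B j n).
Local Notation R' := (fun n => @ker_of K V a B' j' n).
Variables (H : algType K) (i : {linear 'Hom(V, V) -> H}).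
Variables (H' : algType K) (i' : {linear 'Hom(V, V) -> H'}).
Hypothesis pres : end_presentation a R i.
Hypothesis pres' : end_presentation a R' i'.
Hypothesis gen' : generates i'.
Variables s s' : 'End(V).
Hypotheses (sK : cancel s s') (s'K : cancel s' s).
Hypothesis Rs : forall n p (x : word n -> K), R n x -> R n (act a (fun=> lpow s p) x).
Hypothesis Rs' : forall n p (x : word n -> K), R n x -> R n (act a (fun=> lpow s' p) x).
Hypothesis RR' : forall n p (x : word n -> K), (2 <= n)%N -> R n x ->
  R' n (act a (fun l => lpow s (p + l)%N) x).
Hypothesis R'R : forall n p (x : word n -> K), (2 <= n)%N -> R' n x ->
  R n (act a (fun l => lpow s' (p + l)%N) x).
Local Notation g := (lpow s').
Local Notation h := (lpow s).

(** The value of a morphism at a product of entries, when it is [c k l * t]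
    at the entry [z_k^l]. *)
Lemma morphism_entries (C : algType K) (rho : {lrmorphism H -> C})
    (c : 'I_d -> 'I_d -> K) (t : C) (ps : seq ('I_d * 'I_d)) :
  (forall k l, rho (i (zgen a k l)) = c k l *: t) ->
  rho (\prod_(p <- ps) i (zgen a p.1 p.2)) = (\prod_(p <- ps) c p.1 p.2) *: t ^+ size ps.
Proof.
move=> rhoE; elim: ps => [|p ps IHps]; first by rewrite !big_nil rmorph1 scale1r.
have rhoM x y : rho (x * y) = rho x * rho y by apply: rmorphM.
by rewrite !big_cons rhoM rhoE IHps -scalerAl -scalerAr scalerA exprS.
Qed.

Lemma trace_zgen (G : 'End(V)) k l :
  \sum_m coord a m (G (zgen a k l (tnth a m))) = coord a l (G (tnth a k)).
Proof. by under eq_bigr => m _ do rewrite (zgenE aP) !linearZ; rewrite sum_delta. Qed.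

(** The characters [z_k^l |-> a^l (t^r a_k)]. *)
Lemma power_character (t : 'End(V)) :
  (forall n p (x : word n -> K), R n x -> R n (act a (fun=> lpow t p) x)) ->
  exists rho : nat -> {lrmorphism H -> K^o}, forall r psi,
    rho r (i psi) = \sum_m coord a m (lpow t r (psi (tnth a m))).
Proof.
move=> Rt; suff /choice[rho rhoE] : forall r, exists rho : {lrmorphism H -> K^o},
    forall psi, rho (i psi) = \sum_m coord a m (lpow t r (psi (tnth a m))).
  by exists rho.
move=> r; have [n x _ /Rt //|rho rhoE] := character aP pres (g := lpow t r) (1 : K^o).
by exists rho => psi; rewrite rhoE; apply: mulr1.
Qed.

(** The morphism [z_k^l |-> delta_k^l 'X]. *)
Lemma degree_character : exists deg : {lrmorphism H -> {poly K}},
  forall psi, deg (i psi) = (\sum_m coord a m (psi (tnth a m))) *: 'X.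
Proof.
have [n x n2 Rx|deg degE] := character aP pres (g := \1%VF) ('X : {poly K}).
  by rewrite (act_id aP).
exists deg => psi; rewrite degE; congr (_ *: _).
by apply: eq_bigr => m _; rewrite id_lfunE.
Qed.

(** A bialgebra structure given by matrix comultiplication on the images of
    the entries. *)
Definition entry_bialgebra (C : algType K) (u : 'Hom(V, V) -> C)
    (Delta : {linear C -> tens C C}) (eps : {linear C -> K^o}) :=
  [/\ is_bialgebra Delta eps,
      forall k l, Delta (u (zgen a k l)) = \sum_m u (zgen a k m) *t u (zgen a m l)
    & forall k l, eps (u (zgen a k l)) = (k == l)%:R].

Lemma end_bialgebra_exists (C : algType K) (r : V -> C) (D : algType K)
    (u : {linear 'Hom(V, V) -> D}) :
  end_presentation a (fun n => @ker_of K V a C r n) u ->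
  exists (Delta : {linear D -> tens D D}) (eps : {linear D -> K^o}),
    [/\ entry_bialgebra u Delta eps, Delta 1 = 1 *t 1,
      forall x y, Delta (x * y) = tens_mul D D (Delta x *t Delta y),
      forall n (I J : word n), Delta (zword a u I J) = \sum_M zword a u I M *t zword a u M J
    & monoid_morphism eps /\
      forall psi, eps (u psi) = \sum_m coord a m (psi (tnth a m))].
Proof.
move=> pr; have [Delta [Dg D1 DM Dzword]] := coproduct aP pr.
have [e eE] := counit aP pr.
pose eps := linear_map (@linearP _ _ _ _ e).
have epsM : monoid_morphism eps by split; [exact: (rmorph1 e) | exact: (rmorphM e)].
exists Delta, eps; split=> //; split.
- exact: (end_is_bialgebra aP pr D1 DM Dzword epsM eE).
- by move=> k l; apply: Dg.
move=> k l; rewrite /= eE.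
have := trace_zgen \1%VF k l; rewrite id_lfunE (coord_tnth aP) eq_sym => <-.
by apply: eq_bigr => m _; rewrite id_lfunE.
Qed.

(** The twisting theorem for algebras [H] and [H'] presented by two families of
    relations [R] and [R'] which are exchanged by the twist. *)
Lemma twisting_isomorphism :
  exists (Delta : {linear H -> tens H H}) (eps : {linear H -> K^o})
    (Delta' : {linear H' -> tens H' H'}) (eps' : {linear H' -> K^o})
    (chi chi' : {linear tens H H -> K^o}),
  [/\ entry_bialgebra i Delta eps, entry_bialgebra i' Delta' eps',
    [/\ forall ps qs : seq ('I_d * 'I_d),
          chi ((\prod_(p <- ps) i (zgen a p.1 p.2)) *t (\prod_(q <- qs) i (zgen a q.1 q.2))) =
          (\prod_(p <- ps) (p.1 == p.2)%:R) *
          (\prod_(q <- qs) mat_coef a (iter (size ps) s') q.1 q.2),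
        counital_form eps chi, cocycle Delta eps chi
      & conv_inverse Delta eps chi chi']
  & exists ax : algebra_axioms (twisted_mul Delta chi chi') 1,
    [/\ @generates K _ (alg_of ax) i, @is_bialgebra K (alg_of ax) Delta eps
      & exists (f : {lrmorphism alg_of ax -> H'}) (f' : {lrmorphism H' -> alg_of ax}),
        [/\ cancel f f', cancel f' f, forall psi, f (i psi) = i' psi,
          forall psi, f' (i' psi) = i psi
        & forall x, Delta' (f x) = tmap f f (Delta x) /\ eps' (f x) = eps x]]].
Proof.
have [Delta [eps [bi D1 DM Dzword [epsM epsE]]]] := end_bialgebra_exists pres.
have [Delta' [eps' [bi' D1' DM' Dzword' [epsM' epsE']]]] := end_bialgebra_exists pres'.
have [rho rhoE] := power_character Rs'; have [rho' rho'E] := power_character Rs.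
have [deg degE] := degree_character.
have [chi chiE] := graded_form deg (fun r => linear_map (@linearP _ _ _ _ (rho r))).
have [chi' chi'E] := graded_form deg (fun r => linear_map (@linearP _ _ _ _ (rho' r))).
have g0 : g 0 = \1%VF by [].
have gD m n : (g n \o g m)%VF = g (m + n)%N by apply: lpowD.
have ghK n : (h n \o g n)%VF = \1%VF by apply: lpowK.
have hgK n : (g n \o h n)%VF = \1%VF by apply: lpowK.
have [f fE] := twist_map aP pres pres' RR' R'R.
have [f' f'E] := twist_map aP pres' pres R'R RR'.
have fK : cancel f f'.
  apply: (twist_mapK _ fE f'E); last by case: pres.
  by move=> l v; rewrite !lpowE iterK.
have f'K : cancel f' f.
  apply: (twist_mapK _ f'E fE); last by case: pres'.
  by move=> l v; rewrite !lpowE iterK.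
have f1 := twist_map1 fE.
have fi psi : f (i psi) = i' psi.
  by apply: (twist_map_gen fE) => v; rewrite lpowE.
have fM x y : f (twisted_mul Delta chi chi' (x *t y)) = f x * f y.
  move: x; apply: (zword_eq aP pres) => [c x x'|c x x'|n I J].
  - by rewrite tpure_linear_l !linearP.
  - by rewrite linearP scaleDMl.
  move: y; apply: (zword_eq aP pres) => [c y y'|c y y'|m P Q].
  - by rewrite tpure_linear_r !linearP.
  - by rewrite linearP scaleDMr.
  (* Both sides are products of the letters in positions 0, ..., n + m - 1; in
     position n + l the powers of order n cancel. *)
  rewrite (twisted_mul_zword aP Dzword rhoE rho'E degE chiE chi'E).
  rewrite !(twist_map_zword a fE) /zword -(big_letters (fun l => zgen a (I l) (J l))).
  rewrite -(big_letters (fun l => (g n \o zgen a (P l) (Q l) \o h n)%VF)) -big_cat fE.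
  rewrite gprod_cat !gprod_letters size_letters; congr (_ * _).
  apply: eq_bigr => l _; rewrite add0n /=; congr (i' _); apply/lfunP => v.
  by rewrite !comp_lfunE !lpowE (iterD n l s') addnC iterD !iterK.
have fDelta x : Delta' (f x) = tmap f f (Delta x).
  move: x; apply: (zword_eq aP pres) => [c x y|c x y|n I J].
  - by rewrite !linearP.
  - by rewrite !linearP.
  exact: (twist_map_comult aP ghK fE Dzword Dzword').
have feps x : eps' (f x) = eps x.
  move: x; apply: (zword_eq aP pres) => [c x y|c x y|n I J].
  - by rewrite !linearP.
  - exact: linearP.
  rewrite (eps_zword aP epsM epsE).
  exact: (twist_map_counit aP hgK fE (eps_zword aP epsM' epsE')).
pose ax := transport_axioms fK fM f1.
exists Delta, eps, Delta', eps', chi, chi'; split; [exact: bi|exact: bi'| |].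
- split.
  + move=> ps qs.
    have dE : deg (\prod_(p <- ps) i (zgen a p.1 p.2)) =
        (\prod_(p <- ps) (p.1 == p.2)%:R) *: 'X^(size ps).
      apply: (morphism_entries (c := fun k l => (k == l)%:R)) => k l.
      rewrite degE; have := trace_zgen \1%VF k l.
      rewrite id_lfunE (coord_tnth aP) eq_sym => <-; congr (_ *: _).
      by apply: eq_bigr => m _; rewrite id_lfunE.
    rewrite (graded_formE _ chiE dE) /=; congr (_ * _).
    rewrite (morphism_entries (c := mat_coef a (iter (size ps) s')) (t := 1)).
      by rewrite expr1n; apply: mulr1.
    by move=> k l; rewrite rhoE trace_zgen lpowE; apply/esym/mulr1.
  + exact: (chi_counital aP pres epsM epsE g0 rhoE degE chiE).
  + exact: (chi_cocycle aP pres Dzword epsM epsE gD rhoE degE chiE).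
  + exact: (chi_inverse aP pres Dzword epsM epsE ghK hgK rhoE rho'E degE chiE chi'E).
exists ax; split.
- exact: (transport_generates f'K fi gen').
- by case: bi => bi _ _; case: bi' => bi' _ _; exact: (transport_bialgebra fK fM f1 fDelta feps).
have fL : linear (f : alg_of ax -> H') by exact: (@linearP _ _ _ _ f).
have f'L : linear (f' : H' -> alg_of ax) by exact: (@linearP _ _ _ _ f').
exists (algebra_map fL (transport_morphism fK fM f1)).
exists (algebra_map f'L (transport_inverse fK f'K fM f1)).
split.
- exact: fK.
- exact: f'K.
- exact: fi.
- by move=> psi; rewrite -fi; apply: fK.
- by move=> x; split; [exact: fDelta|exact: feps].
Qed.

End Twisting.

(** * Twisting of the bialgebra of quantum endomorphisms *)

(** The twisting theorem over an arbitrary field. *)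
Lemma end_twisting (K : fieldType) (A : qspace K) (sigma : 'End(qs_gen A))
    (a : (\dim {:qs_gen A}).-tuple (qs_gen A)) :
  lker sigma == 0%VS -> extends_to_automorphism sigma -> basis_of {:qs_gen A} a ->
  let E := qend A in
  let Eu := qend (upsilon sigma) in
  exists (Delta : {linear qs_alg E -> tens (qs_alg E) (qs_alg E)})
         (eps : {linear qs_alg E -> K^o})
         (Deltau : {linear qs_alg Eu -> tens (qs_alg Eu) (qs_alg Eu)})
         (epsu : {linear qs_alg Eu -> K^o})
         (chi chi' : {linear tens (qs_alg E) (qs_alg E) -> K^o}),
    end_bialgebra a Delta eps /\
    @end_bialgebra K (upsilon sigma) a Deltau epsu /\
    [/\ associated_form a sigma chi,
        counital_form eps chi,
        cocycle Delta eps chi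
      & conv_inverse Delta eps chi chi'] /\
    exists (ax : algebra_axioms (twisted_mul Delta chi chi') 1)
           (gen : @generates K (qs_gen E) (alg_of ax) (qs_incl E)),
      let Echi := @QSpace K (alg_of ax) (qs_gen E) (qs_incl E) (@qs_incl_inj K E) gen in
      @is_bialgebra K (alg_of ax) Delta eps /\
      exists f : {lrmorphism qs_alg Echi -> qs_alg Eu},
        @qs_isomorphism K Echi Eu f /\
        @bialgebra_morphism K (alg_of ax) (qs_alg Eu) Delta eps Deltau epsu f.
Proof.
move=> ker0 [f [[_ [g [_ fK gK]]] fE]] aP E Eu.
have sK : cancel sigma (sigma^-1)%VF := lker0_lfunK ker0.
have s'K : cancel (sigma^-1)%VF sigma := lker0_lfunVK ker0.
have [Delta [eps [Delta' [eps' [chi [chi' [bi bi' [assoc cou coc inv] [ax [gen biax iso]]]]]]]]] :=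
  @twisting_isomorphism K (qs_gen A) a aP _ (qs_incl A) _ (qs_incl (upsilon sigma))
    (qs_alg E) (qs_incl E) (qs_alg Eu) (qs_incl Eu)
    (@qend_presentation K A a aP) (@qend_presentation K (upsilon sigma) a aP)
    (@qs_generated K Eu) sigma (sigma^-1)%VF sK s'K
    (@ker_sigma K A sigma a aP f fE)
    (@ker_sigma' K A sigma a aP s'K f g fK fE)
    (@ker_to_twist K A sigma a aP f fE)
    (fun n p x _ => @twist_to_ker K A sigma a aP sK s'K f g fK fE n p x).
have [F [F' [FK F'K Fi F'i Fbi]]] := iso.
exists Delta, eps, Delta', eps', chi, chi'; split; first exact: bi.
split; first exact: bi'.
split; first by split; [exact: assoc|exact: cou|exact: coc|exact: inv].
exists ax, gen; split; first exact: biax.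
exists F; split; last exact: Fbi.
split; first by move=> v; exists v; apply: Fi.
exists F'; split; [by move=> v; exists v; apply: F'i|exact: FK|exact: F'K].
Qed.

Theorem theorem5 (R : realType) (k : ground_kind) (A : qspace (ground R k))
    (sigma : 'End(qs_gen A)) (a : (\dim {:qs_gen A}).-tuple (qs_gen A)) :
  conic A ->
  lker sigma == 0%VS ->
  extends_to_automorphism sigma ->
  basis_of {:qs_gen A} a ->
  let K := ground R k in
  let E := qend A in
  let Eu := qend (upsilon sigma) in
  exists (Delta : {linear qs_alg E -> tens (qs_alg E) (qs_alg E)})
         (eps : {linear qs_alg E -> K^o})
         (Deltau : {linear qs_alg Eu -> tens (qs_alg Eu) (qs_alg Eu)})
         (epsu : {linear qs_alg Eu -> K^o})
         (chi chi' : {linear tens (qs_alg E) (qs_alg E) -> K^o}),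
    end_bialgebra a Delta eps /\
    @end_bialgebra K (upsilon sigma) a Deltau epsu /\
    [/\ associated_form a sigma chi,
        counital_form eps chi,
        cocycle Delta eps chi
      & conv_inverse Delta eps chi chi'] /\
    exists (ax : algebra_axioms (twisted_mul Delta chi chi') 1)
           (gen : @generates K (qs_gen E) (alg_of ax) (qs_incl E)),
      let Echi := @QSpace K (alg_of ax) (qs_gen E) (qs_incl E) (@qs_incl_inj K E) gen in
      @is_bialgebra K (alg_of ax) Delta eps /\
      exists f : {lrmorphism qs_alg Echi -> qs_alg Eu},
        @qs_isomorphism K Echi Eu f /\
        @bialgebra_morphism K (alg_of ax) (qs_alg Eu) Delta eps Deltau epsu f.
Proof. by move=> _; apply: end_twisting. Qed.
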